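(* Let $b$ be a connected graph over $(X,m)$ (with no killing term). If $b$ over $(X,m)$ is stochastically complete and the Dirichlet semigroup is Feller, then for every $\alpha>0$ every positive $\alpha$-harmonic function in $\ell^1(X,m)$ is trivial (i.e., identically $0$).
   Context: Graphs: $X$ is a countable discrete set and $m:X\to(0,\infty)$. A graph $b$ over $(X,m)$ (with killing term $c=0$) is a map $b:X\times X\to[0,\infty)$ with $b(x,y)=b(y,x)$, $b(x,x)=0$, $\sum_{y\in X}b(x,y)<\infty$ for all $x$. It is connected if any two vertices $x,y$ are joined by a path $x=x_0,\dots,x_n=y$ with $b(x_k,x_{k+1})>0$. $C_c(X)$ denotes the finitely supported functions; $\ell^p(X,m)$, $p\in[1,\infty)$, has norm $\|f\|_p=(\sum_x|f(x)|^pm(x))^{1/p}$; $\ell^\infty(X)$ is the space of bounded functions. $\alpha$-harmonic functions: let $\mathcal F=\{f:X\to\mathbb R\mid\sum_yb(x,y)|f(y)|<\infty\text{ for all }x\}$ and for $f\in\mathcal F$ let $\Delta f(x)=\frac1{m(x)}\sum_yb(x,y)(f(x)-f(y))$. For $\alpha>0$, $u\in\mathcal F$ is $\alpha$-harmonic if $(\Delta+\alpha)u=0$. Positive means $u\ge0$. Dirichlet semigroup: let $\mathcal Q(f)=\frac12\sum_{x,y}b(x,y)(f(x)-f(y))^2$ for $f:X\to\mathbb R$ for which this is finite. $Q^{(D)}$ is the restriction of $\mathcal Q$ to the closure of $C_c(X)$ with respect to the norm $(\mathcal Q(f)+\|f\|_2^2)^{1/2}$; $L^{(D)}$ is the associated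 nonnegative self-adjoint operator on $\ell^2(X,m)$ and $P^{(D)}_t=e^{-tL^{(D)}}$. As $Q^{(D)}$ is a Dirichlet form, $P^{(D)}_t$ is positivity preserving and extends to a contraction semigroup on all $\ell^p(X,m)$, $p\in[1,\infty]$ (given by the same kernel $p_t(x,y)$, via $P_t^{(D)}f(x)=\sum_yp_t(x,y)f(y)m(y)$). The graph is stochastically complete if $P^{(D)}_t1=1$ for some (equivalently, all) $t>0$, where $1$ is the constant function. Feller property: $C_0(X)$ is the closure of $C_c(X)$ in the supremum norm. The semigroup $P_t$ is Feller if $P_t(C_c(X))\subseteq C_0(X)$ for some (equivalently, all) $t>0$. *)

(* Defs.v *)
From mathcomp Require Import all_boot all_order all_algebra.
From mathcomp Require Import all_classical all_reals all_analysis.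

Set Implicit Arguments.
Unset Strict Implicit.
Unset Printing Implicit Defensive.

Import Order.TTheory GRing.Theory Num.Theory.
Import numFieldNormedType.Exports.

Local Open Scope classical_set_scope.
Local Open Scope ring_scope.

(* Unordered sum of an absolutely summable real family; the value is
   meaningless if the family is not absolutely summable. *)
Definition asum (R : realType) (T : choiceType) (f : T -> R) : R :=
  fine (esum setT (EFin \o f)^\+ - esum setT (EFin \o f)^\-)%E.

Record is_graph (R : realType) (X : countType) (b : X -> X -> R) : Prop := {
  graph_ge0 : forall x y, 0 <= b x y;
  graph_sym : forall x y, b x y = b y x;
  graph_diag : forall x, b x x = 0;
  graph_summable : forall x, (\esum_(y in setT) (b x y)%:E < +oo)%E }.

Definition connected_graph (R : realType) (X : countType) (b : X -> X -> R) :=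
  forall x y : X, exists s : seq X,
    path (fun z w => 0 < b z w) x s /\ last x s = y.

Definition Cc (R : realType) (X : countType) : set (X -> R) :=
  [set f | finite_set [set x | f x != 0]].

Definition C0 (R : realType) (X : countType) : set (X -> R) :=
  [set f | forall e : R, 0 < e ->
    exists2 phi, @Cc R X phi & forall x, `|f x - phi x| <= e].

(* The p-th power of the norm of l^p(X, m). *)
Definition lp_pow (R : realType) (X : countType) (m : X -> R) (p : nat)
    (f : X -> R) : \bar R :=
  \esum_(x in setT) (`|f x| ^+ p * m x)%:E.

Definition lp (R : realType) (X : countType) (m : X -> R) (p : nat) :
    set (X -> R) :=
  [set f | (lp_pow m p f < +oo)%E].

Definition l2dot (R : realType) (X : countType) (m : X -> R) (f g : X -> R) : R :=
  asum (fun x => f x * g x * m x).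

Definition formal_domain (R : realType) (X : countType) (b : X -> X -> R) :
    set (X -> R) :=
  [set f | forall x, (\esum_(y in setT) (b x y * `|f y|)%:E < +oo)%E].

Definition laplacian (R : realType) (X : countType) (m : X -> R)
    (b : X -> X -> R) (f : X -> R) (x : X) : R :=
  (m x)^-1 * asum (fun y => b x y * (f x - f y)).

Definition alpha_harmonic (R : realType) (X : countType) (m : X -> R)
    (b : X -> X -> R) (alpha : R) (u : X -> R) : Prop :=
  formal_domain b u /\ forall x, laplacian m b u x + alpha * u x = 0.

Definition energy (R : realType) (X : countType) (b : X -> X -> R)
    (f : X -> R) : \bar R :=
  ((2^-1)%:E *
    \esum_(z in [set: X * X]) (b z.1 z.2 * (f z.1 - f z.2) ^+ 2)%:E)%E.

Definition energy_dot (R : realType) (X : countType) (b : X -> X -> R)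
    (f g : X -> R) : R :=
  2^-1 * asum (fun z : X * X =>
    b z.1 z.2 * (f z.1 - f z.2) * (g z.1 - g z.2)).

(* Domain of Q^(D): the closure of C_c(X) in the form norm. *)
Definition dirichlet_domain (R : realType) (X : countType) (m : X -> R)
    (b : X -> X -> R) : set (X -> R) :=
  [set f | [/\ (energy b f < +oo)%E, lp m 2 f &
    forall e : R, 0 < e -> exists2 phi, @Cc R X phi &
      (energy b (f \- phi)%R + lp_pow m 2 (f \- phi)%R < (e ^+ 2)%:E)%E]].

(* Graph of the operator L^(D) associated with the closed form Q^(D). *)
Definition dirichlet_laplacian (R : realType) (X : countType) (m : X -> R)
    (b : X -> X -> R) (f g : X -> R) : Prop :=
  [/\ dirichlet_domain m b f, lp m 2 g &
    forall h, dirichlet_domain m b h -> energy_dot b f h = l2dot m g h].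

(* P t = e^{-tL} on l^2(X, m), for an operator L given by its graph: P is the
   strongly continuous contraction semigroup with generator -L.  The values of
   P t outside l^2(X, m), and for t < 0, are irrelevant. *)
Record is_exp_semigroup (R : realType) (X : countType) (m : X -> R)
    (L : (X -> R) -> (X -> R) -> Prop) (P : R -> (X -> R) -> X -> R) : Prop := {
  semigroup_linear : forall t, 0 <= t -> forall (a : R) f g,
    lp m 2 f -> lp m 2 g -> forall x,
    P t (fun y => a * f y + g y) x = a * P t f x + P t g x;
  semigroup_contraction : forall t, 0 <= t -> forall f, lp m 2 f ->
    (lp_pow m 2 (P t f) <= lp_pow m 2 f)%E;
  semigroup_id : forall f, lp m 2 f -> P 0 f = f;
  semigroup_add : forall s t, 0 <= s -> 0 <= t -> forall f, lp m 2 f ->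
    P (s + t) f = P s (P t f);
  semigroup_continuous : forall f, lp m 2 f ->
    lp_pow m 2 (P t f \- f) @[t --> 0^'+] --> 0%E;
  semigroup_generator : forall f g, lp m 2 f -> lp m 2 g ->
    (L f g <->
     lp_pow m 2 (fun x => t^-1 * (f x - P t f x) - g x) @[t --> 0^'+] --> 0%E) }.

Definition is_dirichlet_semigroup (R : realType) (X : countType) (m : X -> R)
    (b : X -> X -> R) (P : R -> (X -> R) -> X -> R) : Prop :=
  is_exp_semigroup m (dirichlet_laplacian m b) P.

Definition heat_kernel (R : realType) (X : countType) (m : X -> R)
    (P : R -> (X -> R) -> X -> R) (t : R) (x y : X) : R :=
  P t (fun z => (z == y)%:R) x / m y.

(* Extension of P t beyond l^2(X, m), in particular to bounded functions. *)
Definition semigroup_ext (R : realType) (X : countType) (m : X -> R)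
    (P : R -> (X -> R) -> X -> R) (t : R) (f : X -> R) (x : X) : R :=
  asum (fun y => heat_kernel m P t x y * f y * m y).

Definition stochastically_complete (R : realType) (X : countType) (m : X -> R)
    (P : R -> (X -> R) -> X -> R) : Prop :=
  exists2 t : R, 0 < t & forall x, semigroup_ext m P t (fun=> 1) x = 1.

Definition feller (R : realType) (X : countType)
    (P : R -> (X -> R) -> X -> R) : Prop :=
  exists2 t : R, 0 < t & forall phi, @Cc R X phi -> @C0 R X (P t phi).

(* Main.v *)
Require Import Defs.
From mathcomp Require Import all_boot all_order all_algebra.
From mathcomp Require Import all_classical all_reals all_analysis.
From mathcomp Require Import ring lra.

Set Implicit Arguments.
Unset Strict Implicit.
Unset Printing Implicit Defensive.

Import Order.TTheory GRing.Theory Num.Theory.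
Import numFieldNormedType.Exports.
Local Open Scope classical_set_scope.
Local Open Scope ring_scope.

(** Write J_h = (1 + h L)^-1 for the resolvent of the Dirichlet Laplacian L, and
    let u >= 0 be alpha-harmonic and integrable, of total mass |u|.  Formally
    e^(alpha t) u solves the heat equation while P_t preserves mass, so if u is
    nonzero then mass must be entering the graph from infinity.  The Feller
    property says that, from far away, a fixed vertex is not reached by time T;
    the two together force u = 0.

    To make this rigorous without differentiating the semigroup, the mass that
    enters during a short time h is measured by the defect
    u_h = u - (1 - h alpha) J_h u.  Since u / (1 - h alpha) is a supersolution
    for the datum u, comparison gives u_h >= 0 ([w_le]).  Stochastic completeness
    means J_h 1 = 1 ([min_sol_one]), so by symmetry J_h preserves mass and u_h has
    mass at most h alpha |u| ([mass_defect]).  On the other hand u_h / h tends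
    to (Delta + alpha) u = 0 at every vertex ([cvg_defect]).  By the resolvent
    identity, h alpha <J_h u, psi> = <u_h, g> where g is J_(1/alpha) psi
    ([dot_defect]).

    For psi = delta_y the part of the resolvent that is collected up to time T is
    dominated by a multiple of P_T delta_y, because p_t(y, .) is at most
    e^(deg(y)/m(y) (T - t)) p_T(y, .).  Hence
      g <= e^(-alpha T) P_T g + C P_T delta_y    ([resolvent_delta_le]).
    Pairing this with u_h, dividing by h alpha and letting h tend to 0 removes the
    second term: P_T delta_y is small off a finite set by the Feller property,
    where the mass of u_h / h is bounded, and u_h / h tends to 0 on that finite
    set.  What is left is m(y) u(y) <= e^(-alpha T) <u, P_T delta_y>
    ([mass_at_vertex]).  Summing over y, and using P_T 1 <= 1, yields
    |u| <= e^(-alpha T) |u|, so u = 0.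

    All order properties of P_T come from those of J_h by the exponential formula
    P_T f = lim J_(T/n)^n f ([exponential_formula]).  For f >= 0 the function J_h f
    is the minimal nonnegative solution of (1 + h Delta) v = f, built as an
    increasing limit of finitely supported iterates; their convergence in form
    norm puts the limit in the domain of the closed form ([dom_min_sol]). *)

(** * Unordered sums over a countable type *)

Section Sums.
Context {R : realType}.

Section OneType.
Context {T : countType}.
Implicit Types f g : T -> R.

(** The elements of code below [k]: an exhaustion by finite sets, along which
    unordered sums become limits of sequences. *)
Definition initseg (k : nat) : seq T := pmap (@pickle_inv T) (iota 0 k).

Lemma mem_initseg k x : (x \in initseg k) = (pickle x < k)%N.
Proof.
rewrite /initseg mem_pmap; apply/mapP/idP => [[n]|xk].
  rewrite mem_iota add0n /= => nk e.
  by have := @pickle_invK T n; rewrite -e /= => ->.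
by exists (pickle x); rewrite ?mem_iota //= pickleK_inv.
Qed.

Lemma initseg_uniq k : uniq (initseg k).
Proof. by apply: (pmap_uniq (@pickle_invK T)); exact: iota_uniq. Qed.

Lemma sub_initseg k l x : (k <= l)%N -> x \in initseg k -> x \in initseg l.
Proof. by rewrite !mem_initseg => kl /leq_trans; exact. Qed.

Lemma initseg_seq (s : seq T) : exists k, {subset s <= initseg k}.
Proof.
elim: s => [|x s [k sk]]; first by exists 0%N.
exists (maxn k (pickle x).+1) => y; rewrite inE => /predU1P[->|/sk].
  by rewrite mem_initseg leq_max ltnSn orbT.
by apply: sub_initseg; exact: leq_maxl.
Qed.

Lemma initseg_set (A : set T) : finite_set A ->
  exists k, forall x, A x -> x \in initseg k.
Proof.
move=> /finite_seqP[s ->]; have [k sk] := initseg_seq s.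
by exists k => x /= /sk.
Qed.

Definition psum (k : nat) f : R := \sum_(x <- initseg k) f x.

Lemma le_psum k f g : (forall x, f x <= g x) -> psum k f <= psum k g.
Proof. by move=> fg; apply: ler_sum. Qed.

Lemma eq_psum k f g : (forall x, f x = g x) -> psum k f = psum k g.
Proof. by move=> fg; apply: eq_bigr. Qed.

Lemma psumD k f g : psum k (fun x => f x + g x) = psum k f + psum k g.
Proof. by rewrite /psum big_split. Qed.

Lemma psumZ k a f : psum k (fun x => a * f x) = a * psum k f.
Proof. by rewrite /psum mulr_sumr. Qed.

Lemma psumB k f g : psum k (fun x => f x - g x) = psum k f - psum k g.
Proof. by rewrite /psum sumrB. Qed.

Lemma psum_le_sub k l f : (forall x, 0 <= f x) ->
  (k <= l)%N -> psum k f <= psum l f.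
Proof.
move=> f0 kl; rewrite /psum /initseg -(subnKC kl) iotaD pmap_cat big_cat /=.
by rewrite lerDl; exact: sumr_ge0.
Qed.

Lemma le1_psum k f x : (forall x, 0 <= f x) -> x \in initseg k -> f x <= psum k f.
Proof.
move=> f0 xk; rewrite /psum (big_rem x)//= lerDl; exact: sumr_ge0.
Qed.

Definition abs_summable f := exists M, forall k, psum k (fun x => `|f x|) <= M.

Lemma esum_leP f (M : R) : (forall x, 0 <= f x) ->
  (\esum_(x in setT) (f x)%:E <= M%:E)%E <-> forall k, psum k f <= M.
Proof.
move=> f0; split=> [h k|h].
  rewrite -lee_fin; apply: le_trans h; apply: esum_ge.
  exists [set` initseg k]; first by split => //; exact: (@finite_seq T).
  by rewrite -fsbig_seq ?initseg_uniq// sumEFin.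
apply: ge_ereal_sup => _ [A [finA _] <-].
have [k Ak] := initseg_set finA.
apply: (@le_trans _ _ (psum k f)%:E); last by rewrite lee_fin.
rewrite /psum -sumEFin (fsbig_seq _ _ (initseg_uniq k)).
apply: lee_fsum_nneg_subset => //.
  by move=> x; rewrite !inE => /Ak.
by move=> x _; rewrite lee_fin.
Qed.

Lemma esum_lty f : (forall x, 0 <= f x) ->
  (\esum_(x in setT) (f x)%:E < +oo)%E <-> abs_summable f.
Proof.
move=> f0; split=> [h|[M h]].
  have e0 : (0 <= \esum_(x in setT) (f x)%:E)%E by apply: esum_ge0 => x _; rewrite lee_fin.
  exists (fine (\esum_(x in setT) (f x)%:E)) => k.
  rewrite (@eq_psum _ _ f); last by move=> x; rewrite ger0_norm.
  move: k; apply/esum_leP => //; rewrite fineK// ge0_fin_numE//.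
apply: le_lt_trans (ltry M); apply/esum_leP => // k.
by rewrite -(@eq_psum k (fun x => `|f x|))// => x; rewrite ger0_norm.
Qed.

Lemma cvg_psum_ge0 f : (forall x, 0 <= f x) -> abs_summable f ->
  psum k f @[k --> \oo] --> fine (\esum_(x in setT) (f x)%:E).
Proof.
move=> f0 bf; have [M fM] := bf.
have fM' k : psum k f <= M.
  by rewrite -(@eq_psum k (fun x => `|f x|))// => x; rewrite ger0_norm.
have /nondecreasing_cvgn : {homo psum^~ f : n m / (n <= m)%N >-> n <= m}.
  by move=> n l; exact: psum_le_sub.
have hub : has_ubound (range (psum^~ f)) by exists M => _ [k _ <-].
move=> /(_ hub); set s := sup _ => ?.
suff -> : \esum_(x in setT) (f x)%:E = s%:E by [].
apply/eqP; rewrite eq_le; apply/andP; split.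
  by apply/esum_leP => // k; apply: ub_le_sup => //; exists k.
have e0 : (0 <= \esum_(x in setT) (f x)%:E)%E by apply: esum_ge0 => x _; rewrite lee_fin.
have ef : \esum_(x in setT) (f x)%:E \is a fin_num.
  by rewrite ge0_fin_numE//; apply/esum_lty.
rewrite -(fineK ef) lee_fin; apply: ge_sup; first by exists (psum 0 f), 0%N.
by move=> _ [k _ <-]; move: k; apply/esum_leP => //; rewrite fineK.
Qed.

Lemma abs_summable_le f g : (forall x, `|f x| <= g x) -> abs_summable g -> abs_summable f.
Proof.
move=> fg [M gM]; exists M => k; apply: le_trans (gM k).
by apply: le_psum => x; apply: le_trans (fg x) (ler_norm _).
Qed.

Lemma abs_summable_eq f g : (forall x, f x = g x) -> abs_summable f -> abs_summable g.
Proof. by move=> /funext ->. Qed.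

Lemma abs_summable_norm f : abs_summable f -> abs_summable (fun x => `|f x|).
Proof.
by move=> [M fM]; exists M => k; rewrite (@eq_psum _ _ (fun x => `|f x|)) => [|x]; [exact: fM|exact: normr_id].
Qed.

Lemma abs_summableD f g : abs_summable f -> abs_summable g ->
  abs_summable (fun x => f x + g x).
Proof.
move=> [M fM] [N gN]; exists (M + N) => k.
apply: le_trans (lerD (fM k) (gN k)); rewrite -psumD.
by apply: le_psum => x; exact: ler_normD.
Qed.

Lemma abs_summableZ a f : abs_summable f -> abs_summable (fun x => a * f x).
Proof.
move=> [M fM]; exists (`|a| * M) => k.
apply: le_trans (ler_wpM2l (normr_ge0 a) (fM k)); rewrite -psumZ.
by apply: le_psum => x; rewrite normrM.
Qed.

Lemma abs_summableB f g : abs_summable f -> abs_summable g ->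
  abs_summable (fun x => f x - g x).
Proof.
move=> bf /(abs_summableZ (-1)) /(abs_summableD bf).
by under eq_fun do rewrite mulN1r.
Qed.

Lemma abs_summable_ge0 f M : (forall x, 0 <= f x) -> (forall k, psum k f <= M) ->
  abs_summable f.
Proof.
move=> f0 h; exists M => k; rewrite (@eq_psum k _ f)// => x; exact: ger0_norm.
Qed.

Lemma asum_esum f : (forall x, 0 <= f x) ->
  asum f = fine (\esum_(x in setT) (f x)%:E).
Proof.
move=> f0; rewrite /asum (_ : esum _ (_)^\-%E = 0%E) ?sube0.
  congr fine; apply: eq_esum => x _ /=.
  by rewrite funeposE /= /maxe; case: ifPn => //; rewrite lte_fin ltNge f0.
by apply: esum1 => x _; rewrite funenegE max_r// oppe_le0 lee_fin.
Qed.

Lemma asum_max f : abs_summable f ->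
  asum f = asum (fun x => Num.max (f x) 0) - asum (fun x => Num.max (- f x) 0).
Proof.
move=> bf.
have p0 x : 0 <= Num.max (f x) 0 by rewrite le_max lexx orbT.
have n0 x : 0 <= Num.max (- f x) 0 by rewrite le_max lexx orbT.
rewrite (asum_esum p0) (asum_esum n0) /asum.
rewrite (_ : (EFin \o f)^\+%E = EFin \o (fun x => Num.max (f x) 0)); last first.
  by apply/funext => x; rewrite funeposE /= -EFin_max.
rewrite (_ : (EFin \o f)^\-%E = EFin \o (fun x => Num.max (- f x) 0)); last first.
  by apply/funext => x; rewrite funenegE /= -EFin_max.
rewrite fineB //.
- rewrite ge0_fin_numE; last by apply: esum_ge0 => x _; rewrite lee_fin.
  apply/esum_lty => //; apply: abs_summable_le (abs_summable_norm bf) => x.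
  by rewrite ger0_norm// ge_max ler_norm normr_ge0.
- rewrite ge0_fin_numE; last by apply: esum_ge0 => x _; rewrite lee_fin.
  apply/esum_lty => //; apply: abs_summable_le (abs_summable_norm bf) => x.
  by rewrite ger0_norm// ge_max -normrN ler_norm normr_ge0.
Qed.

(** Everything about [asum] below is obtained from this: its algebra and order
    properties are those of limits along one fixed exhaustion. *)
Lemma cvg_psum f : abs_summable f -> psum k f @[k --> \oo] --> asum f.
Proof.
move=> bf.
have p0 x : 0 <= Num.max (f x) 0 by rewrite le_max lexx orbT.
have n0 x : 0 <= Num.max (- f x) 0 by rewrite le_max lexx orbT.
have bp : abs_summable (fun x => Num.max (f x) 0).
  apply: abs_summable_le (abs_summable_norm bf) => x.
  by rewrite ger0_norm// ge_max ler_norm normr_ge0.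
have bn : abs_summable (fun x => Num.max (- f x) 0).
  apply: abs_summable_le (abs_summable_norm bf) => x.
  by rewrite ger0_norm// ge_max -normrN ler_norm normr_ge0.
rewrite asum_max// (_ : psum^~ f = fun k => psum k (fun x => Num.max (f x) 0)
    - psum k (fun x => Num.max (- f x) 0)).
  by apply: cvgB; rewrite asum_esum//; exact: cvg_psum_ge0.
apply/funext => k; rewrite -psumB; apply: eq_psum => x.
by rewrite !maxEle; do 2 case: ifPn => //; rewrite -?ltNge; lra.
Qed.

Lemma psum_asum f (l : R) : abs_summable f -> psum k f @[k --> \oo] --> l ->
  asum f = l.
Proof. by move=> /cvg_psum fc fl; exact: (cvg_unique _ fc fl). Qed.

Lemma asum0 : asum (fun _ : T => 0 : R) = 0.
Proof.
apply: psum_asum.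
  by exists 0 => k; rewrite /psum big1// => x _; rewrite normr0.
rewrite (_ : psum^~ _ = fun=> 0); first exact: cvg_cst.
by apply/funext => k; rewrite /psum big1.
Qed.

Lemma asumD f g : abs_summable f -> abs_summable g ->
  asum (fun x => f x + g x) = asum f + asum g.
Proof.
move=> bf bg; apply: psum_asum; first exact: abs_summableD.
under eq_fun do rewrite psumD.
by apply: cvgD; exact: cvg_psum.
Qed.

Lemma asumB f g : abs_summable f -> abs_summable g ->
  asum (fun x => f x - g x) = asum f - asum g.
Proof.
move=> bf bg; apply: psum_asum; first exact: abs_summableB.
under eq_fun do rewrite psumB.
by apply: cvgB; exact: cvg_psum.
Qed.

Lemma asumZ a f : abs_summable f -> asum (fun x => a * f x) = a * asum f.
Proof.
move=> bf; apply: psum_asum; first exact: abs_summableZ.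
under eq_fun do rewrite psumZ.
by apply: cvgMr; exact: cvg_psum.
Qed.

Lemma eq_asum f g : (forall x, f x = g x) -> asum f = asum g.
Proof. by move=> /funext ->. Qed.

Lemma asum_ge0 f : (forall x, 0 <= f x) -> 0 <= asum f.
Proof.
move=> f0; rewrite asum_esum//; apply: fine_ge0; apply: esum_ge0 => x _.
by rewrite lee_fin.
Qed.

Lemma le_asum f g : abs_summable f -> abs_summable g ->
  (forall x, f x <= g x) -> asum f <= asum g.
Proof.
move=> bf bg fg; rewrite -subr_ge0 -asumB//; apply: asum_ge0 => x.
by rewrite subr_ge0.
Qed.

Lemma psum_le_asum k f : (forall x, 0 <= f x) -> abs_summable f ->
  psum k f <= asum f.
Proof.
move=> f0 bf; apply: (cvgr_to_ge (cvg_psum bf)).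
by near=> l; apply: psum_le_sub => //; near: l; exact: nbhs_infty_ge.
Unshelve. all: by end_near. Qed.

Lemma le1_asum f x : (forall x, 0 <= f x) -> abs_summable f -> f x <= asum f.
Proof.
move=> f0 bf; have [k xk] := initseg_seq [:: x].
apply: le_trans (psum_le_asum k f0 bf); apply: le1_psum => //.
by apply: xk; rewrite inE.
Qed.

Lemma asum_le f M : abs_summable f -> (forall k, psum k f <= M) -> asum f <= M.
Proof.
move=> bf fM; apply: (cvgr_to_le (cvg_psum bf)).
by apply: nearW.
Qed.

Lemma esum_asum f : (forall x, 0 <= f x) -> abs_summable f ->
  \esum_(x in setT) (f x)%:E = (asum f)%:E.
Proof.
move=> f0 bf; rewrite asum_esum// fineK// ge0_fin_numE; first exact/esum_lty.
by apply: esum_ge0 => x _; rewrite lee_fin.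
Qed.

Lemma ler_norm_asum f : abs_summable f -> `|asum f| <= asum (fun x => `|f x|).
Proof.
move=> bf; have bnf := abs_summable_norm bf; rewrite ler_norml; apply/andP; split.
  rewrite -mulN1r -asumZ//; apply: le_asum => // [|x]; first exact: abs_summableZ.
  by rewrite mulN1r lerNl -normrN ler_norm.
by apply: le_asum => // x; exact: ler_norm.
Qed.

Lemma psum_supp k l f : (forall x, x \notin initseg k -> f x = 0) ->
  (k <= l)%N -> psum l f = psum k f.
Proof.
move=> fk kl; rewrite /psum /initseg -(subnKC kl) iotaD pmap_cat big_cat /=.
rewrite [X in _ + X]big1_seq ?addr0// => x /= xkl; apply: fk.
rewrite mem_initseg -leqNgt; move: xkl; rewrite mem_pmap => /mapP[n].
rewrite mem_iota add0n /= => /andP[kn _] e.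
by have := @pickle_invK T n; rewrite -e /= => ->.
Qed.

Lemma abs_summable_supp k f : (forall x, x \notin initseg k -> f x = 0) ->
  abs_summable f.
Proof.
move=> fk; exists (psum k (fun x => `|f x|)) => l.
have [kl|/ltnW lk] := leqP k l; last exact: psum_le_sub.
by rewrite (psum_supp _ kl)// => x /fk ->; rewrite normr0.
Qed.

Lemma asum_supp k f : (forall x, x \notin initseg k -> f x = 0) ->
  asum f = psum k f.
Proof.
move=> fk; apply: psum_asum; first exact: abs_summable_supp fk.
apply: cvg_near_cst; near=> l.
by apply: psum_supp => //; near: l; exact: nbhs_infty_ge.
Unshelve. all: by end_near. Qed.

Lemma cvg_psum_fun k (F : nat -> T -> R) f :
  (forall x, F n x @[n --> \oo] --> f x) ->
  psum k (F n) @[n --> \oo] --> psum k f.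
Proof.
move=> Ff; rewrite /psum.
elim: (initseg k) => [|x s ih].
  by under eq_fun do rewrite big_nil; rewrite big_nil; exact: cvg_cst.
by under eq_fun do rewrite big_cons; rewrite big_cons; exact: cvgD.
Qed.

(** Fatou's lemma, stated for partial sums so that it also proves summability of
    the limit; the bounds may vary with [n], which allows combining it with a
    second convergent quantity. *)
Lemma fatou_psum (F : nat -> T -> R) f (M : nat -> R) (N : R) k :
  (forall x, F n x @[n --> \oo] --> f x) -> M n @[n --> \oo] --> N ->
  (forall n, psum k (F n) <= M n) -> psum k f <= N.
Proof.
move=> Ff MN FM; apply: (ler_cvg_to (cvg_psum_fun (k := k) Ff) MN).
exact: nearW.
Qed.

(** Dominated convergence: outside a large finite set all the sums are small
    uniformly in [n], since they are bounded by the tail of [g]. *)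
Lemma tannery (F : nat -> T -> R) f g : abs_summable g ->
  (forall n x, `|F n x| <= g x) -> (forall x, F n x @[n --> \oo] --> f x) ->
  asum (F n) @[n --> \oo] --> asum f.
Proof.
move=> bg Fg Ff.
have g0 x : 0 <= g x by apply: le_trans (Fg 0%N x).
have fg x : `|f x| <= g x.
  apply: (cvgr_to_le (cvg_norm (Ff x))); apply: nearW => n; exact: Fg.
have bf := abs_summable_le fg bg.
have bF n := abs_summable_le (Fg n) bg.
have tail k h : (forall x, `|h x| <= g x) -> `|asum h - psum k h| <= asum g - psum k g.
  move=> hg; have bh := abs_summable_le hg bg.
  (* tails are sums of the family multiplied by this indicator *)
  pose c (x : T) : R := (x \notin initseg k)%:R.
  have E h' : abs_summable h' -> abs_summable (fun x => c x * h' x) /\ asum h' - psum k h' = asum (fun x => c x * h' x).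
    move=> bh'.
    have bc : abs_summable (fun x => (1 - c x) * h' x).
      by apply: (@abs_summable_supp k) => x; rewrite /c => ->; rewrite subrr mul0r.
    have bc' : abs_summable (fun x => c x * h' x).
      apply: abs_summable_le (abs_summable_norm bh') => x; rewrite normrM ler_piMl//.
      by rewrite ger0_norm /c ?ler0n// lern1 leq_b1.
    split => //; rewrite -{1}(_ : (fun x => (1 - c x) * h' x + c x * h' x) = h'); last first.
      by apply/funext => x; ring.
    rewrite asumD// (@asum_supp k); last by move=> x; rewrite /c => ->; rewrite subrr mul0r.
    rewrite addrAC (_ : psum k _ = psum k h') ?subrr ?add0r//.
    by apply: eq_big_seq => x xk; rewrite /c xk subr0 mul1r.
  have [bch ->] := E _ bh; have [bcg ->] := E _ bg.
  apply: le_trans (ler_norm_asum bch) _; apply: le_asum => //; first exact: abs_summable_norm.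
  move=> x; rewrite normrM ger0_norm ?ler0n//.
  by apply: ler_wpM2l => //; rewrite ler0n.
apply/cvgrPdist_le => e e0.
have e3 : 0 < e / 3 by rewrite divr_gt0.
have /cvgrPdist_le/(_ _ e3)[k _ Hk] := cvg_psum bg.
have {}Hk := Hk k (leqnn k).
have Hk' : asum g - psum k g <= e / 3 by apply: le_trans (ler_norm _) Hk.
have /cvgrPdist_le/(_ _ e3) := cvg_psum_fun (k := k) Ff.
apply: filterS => n Hn.
have t1 := tail k f fg; have t2 := tail k (F n) (Fg n).
rewrite (_ : asum f - _ = (asum f - psum k f) + (psum k f - psum k (F n)) - (asum (F n) - psum k (F n))); last by ring.
apply: le_trans (ler_normB _ _) _.
have := ler_normD (asum f - psum k f) (psum k f - psum k (F n)).
lra.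
Qed.

End OneType.

(** Used to collapse sums over pairs of vertices to sums over one row or one
    column. *)
Lemma esum_inj (S T : countType) (j : S -> T) (F : T -> \bar R) : injective j ->
  (forall t, (forall s, j s <> t) -> F t = 0%E) ->
  \esum_(t in setT) F t = \esum_(s in setT) F (j s).
Proof.
move=> ij F0; rewrite -(@esum_image _ _ _ setT j F); last by move=> x y _ _ /ij.
rewrite [RHS]esum_mkcond; apply: eq_esum => t _; case: ifPn => //.
rewrite notin_setE /= => h; apply: F0 => s st; apply: h; by exists s.
Qed.

Lemma asum_inj (S T : countType) (j : S -> T) (f : T -> R) : injective j ->
  (forall t, (forall s, j s <> t) -> f t = 0) ->
  asum f = asum (f \o j).
Proof.
move=> ij f0; rewrite /asum (@esum_inj S T j (EFin \o f)^\+%E)//; last first.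
  by move=> t /f0 h; rewrite funeposE /= h maxxx.
rewrite (@esum_inj S T j (EFin \o f)^\-%E)//; last first.
  by move=> t /f0 h; rewrite funenegE /= h ?EFinN ?oppr0 ?oppe0 maxxx.
congr fine; congr (_ - _)%E; apply: eq_esum => s _.
  by rewrite !funeposE.
by rewrite !funenegE.
Qed.

Lemma abs_summable_inj (S T : countType) (j : S -> T) (f : T -> R) : injective j ->
  (forall t, (forall s, j s <> t) -> f t = 0) ->
  abs_summable (f \o j) -> abs_summable f.
Proof.
move=> ij f0 /abs_summable_norm /esum_lty h.
have [M fM] : abs_summable (fun x => `|f x|).
  apply/esum_lty => //; rewrite (esum_inj ij) ?h// => t /f0 ->.
  by rewrite normr0.
by exists M => k; rewrite -(@eq_psum _ k (fun x => `| `|f x| |))// => x; rewrite normr_id.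
Qed.
End Sums.

(** * Weighted square summable families *)

Section WeightedSquareSummable.
Context {R : realType} {T : countType}.
Variable w : T -> R.
Hypothesis w_ge0 : forall x, 0 <= w x.
Implicit Types F G H : T -> R.

Definition sq_summable F := abs_summable (fun x => F x ^+ 2 * w x).

Definition dot F G : R := asum (fun x => F x * G x * w x).

Lemma dotC F G : dot F G = dot G F.
Proof. by apply: eq_asum => x; rewrite (mulrC (F x)). Qed.

Lemma sq_summable_le F G : (forall x, `|F x| <= `|G x|) ->
  sq_summable G -> sq_summable F.
Proof.
move=> FG; apply: abs_summable_le => x; rewrite normrM (ger0_norm (w_ge0 x)).
by rewrite ler_wpM2r// normrX -[leRHS]real_normK ?num_real// lerXn2r ?nnegrE.
Qed.

Lemma sq_summableD F G : sq_summable F -> sq_summable G ->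
  sq_summable (fun x => F x + G x).
Proof.
move=> sF sG; apply: abs_summable_le (abs_summableD (abs_summableZ 2 sF) (abs_summableZ 2 sG)) => x.
have w0 := w_ge0 x; rewrite ger0_norm; last by rewrite mulr_ge0 ?sqr_ge0.
have : 0 <= (F x - G x) ^+ 2 * w x by rewrite mulr_ge0 ?sqr_ge0.
nra.
Qed.

Lemma sq_summableZ a F : sq_summable F -> sq_summable (fun x => a * F x).
Proof.
move=> /(abs_summableZ (a ^+ 2)); rewrite /sq_summable.
by under eq_fun do rewrite mulrA -exprMn.
Qed.

Lemma sq_summableB F G : sq_summable F -> sq_summable G ->
  sq_summable (fun x => F x - G x).
Proof.
move=> sF /(sq_summableZ (-1)) /(sq_summableD sF).
by under eq_fun do rewrite mulN1r.
Qed.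

Lemma dot_summable F G : sq_summable F -> sq_summable G ->
  abs_summable (fun x => F x * G x * w x).
Proof.
move=> sF sG; apply: abs_summable_le (abs_summableD sF sG) => x.
have w0 := w_ge0 x; rewrite !normrM (ger0_norm w0) -mulrDl ler_wpM2r//.
rewrite -(real_normK (num_real (F x))) -(real_normK (num_real (G x))).
have := normr_ge0 (F x); have := normr_ge0 (G x).
by have := sqr_ge0 (`|F x| - `|G x|); nra.
Qed.

Lemma dotDl F G H : sq_summable F -> sq_summable G -> sq_summable H ->
  dot (fun x => F x + G x) H = dot F H + dot G H.
Proof.
move=> sF sG sH; rewrite /dot -asumD; try exact: dot_summable.
by apply: eq_asum => x; ring.
Qed.

Lemma dotBl F G H : sq_summable F -> sq_summable G -> sq_summable H ->
  dot (fun x => F x - G x) H = dot F H - dot G H.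
Proof.
move=> sF sG sH; rewrite /dot -asumB; try exact: dot_summable.
by apply: eq_asum => x; ring.
Qed.

Lemma dotZl a F H : sq_summable F -> sq_summable H ->
  dot (fun x => a * F x) H = a * dot F H.
Proof.
move=> sF sH; rewrite /dot -asumZ; try exact: dot_summable.
by apply: eq_asum => x; ring.
Qed.

Lemma dot_ge0 F : 0 <= dot F F.
Proof. by apply: asum_ge0 => x; rewrite -expr2 mulr_ge0 ?sqr_ge0. Qed.

Lemma dotBB F G : sq_summable F -> sq_summable G ->
  dot (fun x => F x - G x) (fun x => F x - G x) = dot F F - 2 * dot F G + dot G G.
Proof.
move=> sF sG; have sB := sq_summableB sF sG.
rewrite dotBl// (dotC F) (dotC G) !dotBl// (dotC G F); ring.
Qed.

Lemma dotDD F G : sq_summable F -> sq_summable G ->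
  dot (fun x => F x + G x) (fun x => F x + G x) = dot F F + 2 * dot F G + dot G G.
Proof.
move=> sF sG; have sB := sq_summableD sF sG.
rewrite dotDl// (dotC F) (dotC G) !dotDl// (dotC G F); ring.
Qed.

Lemma dot_young F G : sq_summable F -> sq_summable G ->
  2 * dot F G <= dot F F + dot G G.
Proof.
by move=> sF sG; have := dot_ge0 (fun x => F x - G x); rewrite dotBB//; lra.
Qed.

(** Cauchy-Schwarz, from Young's inequality for the multiples [a F] and [b G]. *)
Lemma dot_CS F G : sq_summable F -> sq_summable G ->
  dot F G ^+ 2 <= dot F F * dot G G.
Proof.
move=> sF sG.
have key a b : 2 * (a * b * dot F G) <= a ^+ 2 * dot F F + b ^+ 2 * dot G G.
  have sa := sq_summableZ a sF; have sb := sq_summableZ b sG.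
  have := dot_young sa sb.
  rewrite (dotZl a sF sb) (dotC F) (dotZl b sG sF) (dotC G F).
  rewrite (dotZl a sF sa) (dotC F (fun x => a * F x)) (dotZl a sF sF).
  by rewrite (dotZl b sG sb) (dotC G (fun x => b * G x)) (dotZl b sG sG); lra.
have f0 := dot_ge0 F; have g0 := dot_ge0 G.
have [G0|Gn0] := eqVneq (dot G G) 0; last first.
  have := key (dot G G) (dot F G); rewrite -subr_ge0 => h.
  have Gp : 0 < dot G G by rewrite lt_neqAle eq_sym Gn0.
  rewrite -subr_ge0 -(pmulr_rge0 _ Gp); lra.
suff -> : dot F G = 0 by rewrite expr0n mulr_ge0.
have h1 b := key 1 b.
rewrite G0 in h1.
have [//|n0] := eqVneq (dot F G) 0.
(* with [dot G G = 0] this multiple of [G] would give [dot F F + 1 <= dot F F] *)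
by have := h1 ((dot F F + 1) / 2 / dot F G); rewrite mul1r divfK//; lra.
Qed.

Definition norm2 F : R := Num.sqrt (dot F F).

Lemma norm2_ge0 F : 0 <= norm2 F. Proof. exact: sqrtr_ge0. Qed.

Lemma sqr_norm2 F : norm2 F ^+ 2 = dot F F.
Proof. by rewrite sqr_sqrtr// dot_ge0. Qed.

Lemma norm2_le F M : 0 <= M -> (norm2 F <= M) = (dot F F <= M ^+ 2).
Proof.
by move=> M0; rewrite -sqr_norm2 ler_sqr ?nnegrE ?norm2_ge0.
Qed.

Lemma ler_dot F G : sq_summable F -> sq_summable G ->
  `|dot F G| <= norm2 F * norm2 G.
Proof.
move=> sF sG; rewrite -ler_sqr ?nnegrE ?mulr_ge0 ?norm2_ge0//.
by rewrite real_normK ?num_real// exprMn !sqr_norm2; exact: dot_CS.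
Qed.

Lemma norm2D F G : sq_summable F -> sq_summable G ->
  norm2 (fun x => F x + G x) <= norm2 F + norm2 G.
Proof.
move=> sF sG; rewrite norm2_le ?addr_ge0 ?norm2_ge0// dotDD// sqrrD !sqr_norm2.
have := ler_dot sF sG; have := ler_norm (dot F G); lra.
Qed.

Lemma norm2Z a F : sq_summable F -> norm2 (fun x => a * F x) = `|a| * norm2 F.
Proof.
move=> sF; rewrite /norm2 dotZl//; last exact: sq_summableZ.
rewrite dotC dotZl// mulrA -expr2 sqrtrM ?sqr_ge0// sqrtr_sqr//.
Qed.

Lemma norm2B F G : sq_summable F -> sq_summable G ->
  norm2 (fun x => F x - G x) <= norm2 F + norm2 G.
Proof.
move=> sF sG; have := norm2D sF (sq_summableZ (-1) sG).
rewrite norm2Z// normrN1 mul1r.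
by under [X in norm2 X]eq_fun do rewrite mulN1r.
Qed.

Lemma sq_summable_fatou (F : nat -> T -> R) G (M : nat -> R) (N : R) :
  (forall x, F n x @[n --> \oo] --> G x) -> M n @[n --> \oo] --> N ->
  (forall n, sq_summable (F n)) -> (forall n, dot (F n) (F n) <= M n) ->
  sq_summable G /\ dot G G <= N.
Proof.
move=> FG MN sF FM.
have bd k : psum k (fun x => G x ^+ 2 * w x) <= N.
  apply: (@fatou_psum _ _ (fun n x => F n x ^+ 2 * w x) _ M) => // [x|n].
    by apply: cvgMl; rewrite /GRing.exp/=; apply: cvgM; exact: FG.
  apply: le_trans (FM n); rewrite /dot; under eq_asum do rewrite -expr2.
  by apply: psum_le_asum (sF n) => x; rewrite mulr_ge0 ?sqr_ge0.
have sG : sq_summable G.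
  by apply: abs_summable_ge0 bd => x; rewrite mulr_ge0 ?sqr_ge0.
split => //; rewrite /dot; under eq_asum do rewrite -expr2.
exact: asum_le.
Qed.

Lemma le1_dot F x : sq_summable F -> F x ^+ 2 * w x <= dot F F.
Proof.
move=> sF; rewrite /dot; under eq_asum do rewrite -expr2.
by apply: (le1_asum (f := fun x => F x ^+ 2 * w x)) => // y; rewrite mulr_ge0 ?sqr_ge0.
Qed.

Lemma dot_eq0 F x : 0 < w x -> sq_summable F -> dot F F = 0 -> F x = 0.
Proof.
move=> wx sF F0; have := le1_dot x sF; rewrite F0 pmulr_lle0// => h.
by apply/eqP; rewrite -(sqrf_eq0 (F x)) eq_le h sqr_ge0.
Qed.

End WeightedSquareSummable.

(** * The energy form and Green's formula *)

Section Graph.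
Context {R : realType} {X : countType} (m : X -> R) (b : X -> X -> R).
Hypothesis m_gt0 : forall x, 0 < m x.
Hypothesis hb : is_graph b.

(** Every edge occurs in both orientations, hence the factor one half: with these
    weights the energy of [f] is the square norm of [grad f]. *)
Definition edge_weight (z : X * X) : R := 2^-1 * b z.1 z.2.

Definition grad (f : X -> R) (z : X * X) : R := f z.1 - f z.2.

Definition deg (x : X) : R := asum (b x).

Definition nbr (f : X -> R) (x : X) : R := asum (fun y => b x y * f y).

Definition nbr_summable (f : X -> R) :=
  forall x, abs_summable (fun y => b x y * f y).

(** The function [m (1 + h Delta) f]; keeping the weight [m] avoids divisions. *)
Definition shifted (h : R) (f : X -> R) (x : X) : R :=
  m x * f x + h * (deg x * f x - nbr f x).

Definition delta (y x : X) : R := (x == y)%:R.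

Lemma formal_domainE f : formal_domain b f <-> nbr_summable f.
Proof.
have E x : ((\esum_(y in setT) (b x y * `|f y|)%:E < +oo)%E <->
    abs_summable (fun y => b x y * f y)).
  rewrite esum_lty => [|y]; last by rewrite mulr_ge0 ?(graph_ge0 hb).
  split=> [|/abs_summable_norm]; [apply: abs_summable_le|apply: abs_summable_eq];
    by move=> y; rewrite normrM (ger0_norm (graph_ge0 hb x y)).
by split=> fd x; apply/E.
Qed.

Definition fin_supp (f : X -> R) := exists k, forall x, x \notin initseg k -> f x = 0.

Definition form_finite (f : X -> R) :=
  sq_summable m f /\ sq_summable edge_weight (grad f).

Definition form (h : R) (f g : X -> R) : R :=
  dot m f g + h * dot edge_weight (grad f) (grad g).

Let m_ge0 x : 0 <= m x := ltW (m_gt0 x).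

Lemma edge_weight_ge0 z : 0 <= edge_weight z.
Proof. by rewrite mulr_ge0 ?invr_ge0 ?(graph_ge0 hb). Qed.

Lemma b_summable x : abs_summable (b x).
Proof. by apply/esum_lty; [exact: (graph_ge0 hb)|exact: (graph_summable hb)]. Qed.

Lemma deg_ge0 x : 0 <= deg x.
Proof. by apply: asum_ge0 => y; exact: (graph_ge0 hb). Qed.

Lemma l2dotE f g : l2dot m f g = dot m f g. Proof. by []. Qed.

Lemma lp2E f : lp m 2 f <-> sq_summable m f.
Proof.
rewrite /lp /lp_pow /= (_ : sq_summable m f = abs_summable (fun x => `|f x| ^+ 2 * m x)).
  by apply: esum_lty => x; rewrite mulr_ge0 ?exprn_ge0.
by congr abs_summable; apply/funext => x; rewrite real_normK ?num_real.
Qed.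

Lemma lp_powE f : sq_summable m f -> lp_pow m 2 f = (dot m f f)%:E.
Proof.
move=> sf; rewrite /lp_pow /dot -esum_asum => [|x|].
- by apply: eq_esum => x _; rewrite real_normK ?num_real// expr2.
- by rewrite -expr2 mulr_ge0 ?sqr_ge0.
- exact: dot_summable.
Qed.

Lemma energy_ltyE f : (energy b f < +oo)%E <-> sq_summable edge_weight (grad f).
Proof.
rewrite /energy; set E := esum _ _.
have E0 : (0 <= E)%E.
  by apply: esum_ge0 => z _; rewrite lee_fin mulr_ge0 ?sqr_ge0 ?(graph_ge0 hb).
have -> : (2^-1%:E * E < +oo)%E = (E < +oo)%E.
  case: E E0 => [r||]//= _; last by rewrite gt0_muley ?lte_fin ?invr_gt0.
  by rewrite -EFinM !ltry.
rewrite /E esum_lty; last by move=> z; rewrite mulr_ge0 ?sqr_ge0 ?(graph_ge0 hb).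
split => [/(abs_summableZ 2^-1)|/(abs_summableZ 2)]; apply: abs_summable_eq => z;
  by rewrite /edge_weight /grad; field.
Qed.

Lemma energyE f : sq_summable edge_weight (grad f) ->
  energy b f = (dot edge_weight (grad f) (grad f))%:E.
Proof.
move=> sf; rewrite /energy /dot.
rewrite (_ : esum _ _ = (asum (fun z => b z.1 z.2 * (f z.1 - f z.2) ^+ 2))%:E).
  rewrite -EFinM -asumZ.
    by congr EFin; apply: eq_asum => z; rewrite /edge_weight /grad; ring.
  by move: sf => /(abs_summableZ 2); apply: abs_summable_eq => z; rewrite /edge_weight /grad; field.
apply: esum_asum => [z|].
  by rewrite mulr_ge0 ?sqr_ge0 ?(graph_ge0 hb).
by move: sf => /(abs_summableZ 2); apply: abs_summable_eq => z; rewrite /edge_weight /grad; field.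
Qed.

Lemma energy_dotE f g : sq_summable edge_weight (grad f) ->
  sq_summable edge_weight (grad g) ->
  energy_dot b f g = dot edge_weight (grad f) (grad g).
Proof.
move=> sf sg; rewrite /energy_dot /dot.
rewrite (_ : asum _ = asum (fun z => 2 * (grad f z * grad g z * edge_weight z))).
  rewrite asumZ; last exact: (dot_summable edge_weight_ge0 sf sg).
  by rewrite mulrA mulVf// mul1r.
by apply: eq_asum => z; rewrite /edge_weight /grad; field.
Qed.

Lemma fin_suppP f : Cc f <-> fin_supp f.
Proof.
split => [/initseg_set[k fk]|[k fk]].
  exists k => x xk; apply/eqP; apply: contraNT xk; exact: fk.
apply: (sub_finite_set (B := [set` initseg k])); last exact: (@finite_seq X).
by move=> x /=; apply: contraNT => /fk ->.
Qed.

Lemma fin_supp_lin a f g : fin_supp f -> fin_supp g ->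
  fin_supp (fun x => a * f x + g x).
Proof.
move=> [k fk] [l gl]; exists (maxn k l) => x xkl.
rewrite fk ?gl ?mulr0 ?addr0//; apply: contraNN xkl.
  by apply: sub_initseg; exact: leq_maxr.
by apply: sub_initseg; exact: leq_maxl.
Qed.

Lemma nbr_summable_fin_supp f : fin_supp f -> nbr_summable f.
Proof.
by move=> [k fk] x; apply: (@abs_summable_supp _ _ k) => y /fk ->; rewrite mulr0.
Qed.

Lemma sq_fin_supp f : fin_supp f -> sq_summable m f.
Proof.
by move=> [k fk]; apply: (@abs_summable_supp _ _ k) => y /fk ->; rewrite expr0n mul0r.
Qed.

Lemma pair_fst_inj (x : X) : injective (fun y : X => (x, y)). Proof. by move=> y z []. Qed.
Lemma pair_snd_inj (x : X) : injective (fun y : X => (y, x)). Proof. by move=> y z []. Qed.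

Lemma delta_fst_supp (x : X) (F : X * X -> R) (z : X * X) : (forall y, (x, y) <> z) ->
  delta x z.1 * F z = 0.
Proof.
rewrite /delta; case: eqP => [<-|_ _]; last by rewrite mul0r.
by move=> /(_ z.2); case: z.
Qed.

Lemma delta_snd_supp (x : X) (F : X * X -> R) (z : X * X) : (forall y, (y, x) <> z) ->
  delta x z.2 * F z = 0.
Proof.
rewrite /delta; case: eqP => [<-|_ _]; last by rewrite mul0r.
by move=> /(_ z.1); case: z.
Qed.

Lemma sq_grad_delta x : sq_summable edge_weight (grad (delta x)).
Proof.
have b1 : abs_summable (fun z : X * X => delta x z.1 * edge_weight z).
  apply: (abs_summable_inj (@pair_fst_inj x)); first by move=> z; exact: delta_fst_supp.
  apply: abs_summable_le (b_summable x) => y /=.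
  rewrite /delta eqxx mul1r ger0_norm ?edge_weight_ge0// /edge_weight/=.
  by have := graph_ge0 hb x y; lra.
have b2 : abs_summable (fun z : X * X => delta x z.2 * edge_weight z).
  apply: (abs_summable_inj (@pair_snd_inj x)); first by move=> z; exact: delta_snd_supp.
  apply: abs_summable_le (b_summable x) => y /=.
  rewrite /delta eqxx mul1r ger0_norm ?edge_weight_ge0// /edge_weight/=.
  by have := graph_ge0 hb x y; rewrite (graph_sym hb); lra.
apply: abs_summable_le (abs_summableD b1 b2) => z; rewrite -mulrDl normrM.
rewrite (ger0_norm (edge_weight_ge0 z)) ler_wpM2r ?edge_weight_ge0//.
rewrite /grad /delta; case: eqP => _; case: eqP => _ /=;
  rewrite ?subrr ?subr0 ?sub0r ?sqrrN ?expr1n ?expr0n ?normr1 ?normr0; lra.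
Qed.

Lemma laplacianE f x : nbr_summable f ->
  laplacian m b f x = (m x)^-1 * (deg x * f x - nbr f x).
Proof.
move=> nf; rewrite /laplacian /deg /nbr; congr (_ * _).
have bx := abs_summableZ (f x) (b_summable x).
rewrite (mulrC (asum (b x))) -(asumZ (f x) (b_summable x)) -(asumB bx (nf x)).
by apply: eq_asum => y; ring.
Qed.

(** Only the row and the column of [x] contribute to the double sum, and by the
    symmetry of [b] they contribute equally. *)
Lemma green_delta v x : nbr_summable v ->
  dot edge_weight (grad v) (grad (delta x)) = deg x * v x - nbr v x.
Proof.
move=> nv.
have bx : abs_summable (fun y => b x y * (v x - v y)).
  have := abs_summableB (abs_summableZ (v x) (b_summable x)) (nv x).
  by apply: abs_summable_eq => y; ring.
pose G (z : X * X) := grad v z * edge_weight z.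
have G1 y : delta x (x, y).1 * G (x, y) = 2^-1 * (b x y * (v x - v y)).
  by rewrite /G /delta eqxx /grad /edge_weight /=; ring.
have G2 y : - delta x (y, x).2 * G (y, x) = 2^-1 * (b x y * (v x - v y)).
  by rewrite /G /delta eqxx /grad /edge_weight /= (graph_sym hb y); ring.
have s1 z : (forall y, (x, y) <> z) -> delta x z.1 * G z = 0.
  exact: delta_fst_supp.
have s2 z : (forall y, (y, x) <> z) -> - delta x z.2 * G z = 0.
  by move=> /(delta_snd_supp G); rewrite mulNr => ->; rewrite oppr0.
have b1 : abs_summable (fun z => delta x z.1 * G z).
  apply: (abs_summable_inj (@pair_fst_inj x) s1).
  by under [X in abs_summable X]eq_fun do rewrite /= G1; exact: abs_summableZ.
have b2 : abs_summable (fun z => - delta x z.2 * G z).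
  apply: (abs_summable_inj (@pair_snd_inj x) s2).
  by under [X in abs_summable X]eq_fun do rewrite /= G2; exact: abs_summableZ.
rewrite /dot (_ : asum _ = asum (fun z => delta x z.1 * G z + - delta x z.2 * G z)); last first.
  by apply: eq_asum => z; rewrite /G {2}/grad; ring.
rewrite asumD// (asum_inj (@pair_fst_inj x) s1) (asum_inj (@pair_snd_inj x) s2).
rewrite (@eq_asum _ _ _ (fun y => 2^-1 * (b x y * (v x - v y)))); last exact: G1.
rewrite (@eq_asum _ _ (_ \o _) (fun y => 2^-1 * (b x y * (v x - v y)))); last exact: G2.
rewrite asumZ// -mulrDl (_ : 2^-1 + 2^-1 = 1) ?mul1r; last by field.
rewrite (@eq_asum _ _ _ (fun y => v x * b x y - b x y * v y)); last by move=> y; ring.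
rewrite asumB; first last.
- exact: nv.
- by apply: abs_summableZ; exact: b_summable.
by rewrite asumZ ?(mulrC (v x))//; exact: b_summable.
Qed.

Lemma grad_lin a f g :
  grad (fun x => a * f x + g x) = fun z => a * grad f z + grad g z.
Proof. by apply/funext => z; rewrite /grad; ring. Qed.

Lemma fin_supp_sum k f : (forall x, x \notin initseg k -> f x = 0) ->
  f = fun x => \sum_(y <- initseg k) f y * delta y x.
Proof.
move=> fk; apply/funext => x; have [xk|xk] := boolP (x \in initseg k).
  rewrite (bigD1_seq x) ?initseg_uniq//= /delta eqxx mulr1 big1 ?addr0// => y.
  by rewrite eq_sym => /negbTE ->; rewrite mulr0.
rewrite fk// big1_seq// => y /= yk; rewrite /delta.
by case: eqP yk xk => [<- -> //|_ _ _]; rewrite mulr0.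
Qed.

(** Linear combinations of point masses over an arbitrary sequence, to allow an
    induction. *)
Lemma green_seq (s : seq X) c :
  let f := fun x => \sum_(y <- s) c y * delta y x in
  sq_summable edge_weight (grad f) /\
  forall v, nbr_summable v -> sq_summable edge_weight (grad v) ->
  dot edge_weight (grad v) (grad f) = \sum_(y <- s) c y * (deg y * v y - nbr v y).
Proof.
elim: s => [|y s [sf ih]] /=.
  have E : grad (fun x => \sum_(y <- [::]) c y * delta y x) = fun=> 0.
    by apply/funext => z; rewrite /grad !big_nil subrr.
  rewrite E; split=> [|v _ _].
    by apply: (@abs_summable_supp _ _ 0%N) => z _; rewrite expr0n mul0r.
  rewrite big_nil /dot -[RHS](@asum0 R (X * X)%type); apply: eq_asum => z.
  by rewrite mulr0 mul0r.
have E : grad (fun x => \sum_(z <- y :: s) c z * delta z x) =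
    fun z => c y * grad (delta y) z + grad (fun x => \sum_(y <- s) c y * delta y x) z.
  by rewrite -grad_lin; congr grad; apply/funext => x; rewrite big_cons.
have sd := sq_grad_delta y.
have scd := sq_summableZ (c y) sd.
rewrite E; split=> [|v nv sv]; first exact: (sq_summableD edge_weight_ge0).
rewrite big_cons dotC (dotDl edge_weight_ge0)// (dotZl edge_weight_ge0)//.
by rewrite (dotC _ _ (grad v)) green_delta// (dotC _ _ (grad v)) ih.
Qed.

Lemma sq_grad_fin_supp f : fin_supp f -> sq_summable edge_weight (grad f).
Proof.
by move=> [k fk]; rewrite (fin_supp_sum fk); have [] := green_seq (initseg k) f.
Qed.

Lemma form_finite_fin_supp f : fin_supp f -> form_finite f.
Proof. by move=> ff; split; [exact: sq_fin_supp|exact: sq_grad_fin_supp]. Qed.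

(** Green's formula.  No boundary term appears because [f] vanishes outside a
    finite set. *)
Lemma green h v f k : form_finite v -> nbr_summable v ->
  (forall x, x \notin initseg k -> f x = 0) ->
  form h v f = psum k (fun x => f x * shifted h v x).
Proof.
move=> [_ sv] nv fk; rewrite /form {1}/dot (@asum_supp _ _ k); last first.
  by move=> x /fk ->; rewrite mulr0 mul0r.
rewrite {2}(fin_supp_sum fk); have [_ ->//] := green_seq (initseg k) f.
rewrite -/(psum k _) -psumZ -psumD; apply: eq_psum => x; rewrite /shifted; ring.
Qed.

Lemma formC h f g : form h f g = form h g f.
Proof. by rewrite /form dotC [in X in _ + X]dotC. Qed.

Lemma form_finite_lin a f g : form_finite f -> form_finite g ->
  form_finite (fun x => a * f x + g x).
Proof.
move=> [sf gf] [sg gg]; split.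
  by apply: sq_summableD => //; exact: sq_summableZ.
rewrite grad_lin; apply: (sq_summableD edge_weight_ge0) => //.
exact: sq_summableZ.
Qed.

Lemma form_finiteB f g : form_finite f -> form_finite g ->
  form_finite (fun x => f x - g x).
Proof.
move=> ff /(form_finite_lin (-1)) /(_ ff).
by under eq_fun do rewrite mulN1r addrC.
Qed.

Lemma form_lin h a f g k : form_finite f -> form_finite g -> form_finite k ->
  form h (fun x => a * f x + g x) k = a * form h f k + form h g k.
Proof.
move=> [sf gf] [sg gg] [sk gk].
rewrite /form (dotDl m_ge0) ?(dotZl m_ge0)//; last exact: sq_summableZ.
rewrite grad_lin (dotDl edge_weight_ge0) ?(dotZl edge_weight_ge0)//; first by ring.
exact: sq_summableZ.
Qed.

Lemma formB h f g k : form_finite f -> form_finite g -> form_finite k ->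
  form h (fun x => f x - g x) k = form h f k - form h g k.
Proof.
move=> ff fg fk; have := form_lin h (-1) fg ff fk.
under [X in form h X]eq_fun do rewrite mulN1r addrC.
by move=> ->; ring.
Qed.

Lemma form_ge0 h f : 0 <= h -> 0 <= form h f f.
Proof.
move=> h0; rewrite addr_ge0 ?dot_ge0//.
by rewrite mulr_ge0// (dot_ge0 edge_weight_ge0).
Qed.

Lemma formBB h f g : form_finite f -> form_finite g ->
  form h (fun x => f x - g x) (fun x => f x - g x) =
  form h f f - 2 * form h f g + form h g g.
Proof.
move=> ff fg; have fB := form_finiteB ff fg.
rewrite formB// (formC h f) (formC h g) !formB// (formC h g f); ring.
Qed.

(** * The form domain *)

Definition dom := dirichlet_domain m b.

Lemma domP f : dom f <-> form_finite f /\ forall e, 0 < e ->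
  exists2 phi, fin_supp phi &
    form 1 (fun x => f x - phi x) (fun x => f x - phi x) < e ^+ 2.
Proof.
have E phi : form_finite f -> fin_supp phi ->
    (energy b (f \- phi)%R + lp_pow m 2 (f \- phi)%R)%E =
    (form 1 (fun x => f x - phi x) (fun x => f x - phi x))%:E.
  move=> ff /form_finite_fin_supp fphi; have [s g] := form_finiteB ff fphi.
  by rewrite energyE// lp_powE// -EFinD /form mul1r addrC.
split=> [[/energy_ltyE gf /lp2E sf h]|[[sf gf] h]].
  split=> // e /h[phi /fin_suppP fphi]; rewrite E// lte_fin => ?.
  by exists phi.
split; [exact/energy_ltyE|exact/lp2E|move=> e /h[phi fphi hphi]].
by exists phi; [exact/fin_suppP|rewrite E// lte_fin].
Qed.

Lemma dom_finite f : dom f -> form_finite f. Proof. by case/domP. Qed.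

Lemma dom_fin_supp f : fin_supp f -> dom f.
Proof.
move=> ff; apply/domP; split=> [|e e0]; first exact: form_finite_fin_supp.
exists f => //; rewrite formBB; try exact: form_finite_fin_supp.
by rewrite (_ : _ - _ + _ = 0) ?exprn_gt0//; ring.
Qed.

Lemma form_linlin h a f g : form_finite f -> form_finite g ->
  form h (fun x => a * f x + g x) (fun x => a * f x + g x) =
  a ^+ 2 * form h f f + 2 * a * form h f g + form h g g.
Proof.
move=> ff fg; have fl := form_finite_lin a ff fg.
rewrite form_lin// (formC h f) (formC h g) !form_lin// (formC h g f); ring.
Qed.

(** Half of the parallelogram law. *)
Lemma form_lin_le h a f g : 0 <= h -> form_finite f -> form_finite g ->
  form h (fun x => a * f x + g x) (fun x => a * f x + g x) <=
  2 * a ^+ 2 * form h f f + 2 * form h g g.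
Proof.
move=> h0 ff fg; have := form_ge0 (fun x => (- a) * f x + g x) h0.
by rewrite !form_linlin// sqrrN; lra.
Qed.

Lemma dom_lin a f g : dom f -> dom g -> dom (fun x => a * f x + g x).
Proof.
move=> /domP[ff fd] /domP[fg gd]; apply/domP; split=> [|e e0].
  exact: form_finite_lin.
have a1 : 0 < `|a| + 1 by rewrite ltr_wpDl.
pose d := e / (2 * (`|a| + 1)).
have d0 : 0 < d by rewrite divr_gt0// mulr_gt0.
have [phi phif phid] := fd _ d0.
have [psi psif psid] := gd _ d0.
exists (fun x => a * phi x + psi x); first exact: fin_supp_lin.
pose F x := f x - phi x; pose G x := g x - psi x.
have fF : form_finite F by apply: form_finiteB => //; exact: form_finite_fin_supp.
have fG : form_finite G by apply: form_finiteB => //; exact: form_finite_fin_supp.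
rewrite (_ : (fun x => _ - _) = fun x => a * F x + G x); last first.
  by apply/funext => x; rewrite /F /G; ring.
apply: le_lt_trans (form_lin_le a ler01 fF fG) _.
have -> : e = d * (2 * (`|a| + 1)) by rewrite divfK// mulf_neq0// gt_eqF.
have A : a ^+ 2 = `|a| ^+ 2 by rewrite real_normK ?num_real.
have := normr_ge0 a; rewrite A exprMn => ha.
have l1 : 2 * `|a| ^+ 2 * form 1 F F <= 2 * `|a| ^+ 2 * d ^+ 2.
  by apply: ler_wpM2l; [rewrite mulr_ge0 ?exprn_ge0|exact: ltW].
have d2 : 0 < d ^+ 2 by rewrite exprn_gt0.
have : 0 <= d ^+ 2 * (2 * `|a| ^+ 2 + 8 * `|a|) by apply: mulr_ge0; [exact: ltW|have := sqr_ge0 `|a|; lra].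
move: psid; rewrite -/G; nra.
Qed.

Lemma domB f g : dom f -> dom g -> dom (fun x => f x - g x).
Proof.
move=> df /(dom_lin (-1)) /(_ df).
by under eq_fun do rewrite mulN1r addrC.
Qed.

Lemma small_eq0 (z C : R) : 0 <= C -> (forall e, 0 < e -> `|z| <= C * e) -> z = 0.
Proof.
move=> C0 h; apply/eqP; rewrite -normr_eq0 eq_le normr_ge0 andbT.
apply/ler_addgt0Pr => e e0; rewrite add0r.
have C1 : 0 < C + 1 by rewrite ltr_wpDl.
apply: le_trans (h (e / (C + 1)) _) _; first by rewrite divr_gt0.
by rewrite mulrA ler_pdivrMr//; nra.
Qed.

(** Both sides are continuous in [psi] for the form norm, in which finitely
    supported functions are dense by the definition of the domain. *)
Lemma weak_ext h v f : 0 <= h -> form_finite v -> sq_summable m f ->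
  (forall phi, fin_supp phi -> form h v phi = dot m f phi) ->
  forall psi, dom psi -> form h v psi = dot m f psi.
Proof.
move=> h0 fv sf weak psi /domP[fpsi hpsi]; apply/eqP; rewrite -subr_eq0; apply/eqP.
pose C := norm2 m v + h * norm2 edge_weight (grad v) + norm2 m f.
apply: (@small_eq0 _ C) => [|e e0].
  by rewrite /C !addr_ge0 ?mulr_ge0 ?norm2_ge0.
have [phi phif re] := hpsi _ e0; pose r x := psi x - phi x; rewrite -/r in re.
have fphi := form_finite_fin_supp phif.
have fr : form_finite r by exact: form_finiteB.
have [sr gr] := fr; have [sv gv] := fv.
have re1 : norm2 m r <= e.
  rewrite (norm2_le m_ge0) ?(ltW e0)//; apply: (le_trans _ (ltW re)).
  by rewrite /form lerDl mul1r (dot_ge0 edge_weight_ge0).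
have re2 : norm2 edge_weight (grad r) <= e.
  rewrite (norm2_le edge_weight_ge0) ?(ltW e0)//; apply: (le_trans _ (ltW re)).
  by rewrite /form mul1r lerDr (dot_ge0 m_ge0).
have -> : form h v psi - dot m f psi = form h v r - dot m f r.
  rewrite (formC h v r) formB// (formC h psi) (formC h phi) (weak _ phif).
  by rewrite (dotC m f r) (dotBl m_ge0)//; [rewrite !(dotC m _ f); ring|case: fpsi|case: fphi].
rewrite /form.
have t1 := ler_dot m_ge0 sv sr; have t2 := ler_dot edge_weight_ge0 gv gr.
have t3 := ler_dot m_ge0 sf sr.
have n1 := norm2_ge0 m v; have n2 := norm2_ge0 edge_weight (grad v).
have n3 := norm2_ge0 m f.
have u1 := ler_wpM2l n1 re1; have u2 := ler_wpM2l n2 re2; have u3 := ler_wpM2l n3 re1.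
apply: le_trans (ler_normB _ _) _.
apply: le_trans (lerD (ler_normD _ _) (lexx _)) _.
rewrite normrM (ger0_norm h0) /C.
have w1 := le_trans t1 u1; have w3 := le_trans t3 u3.
have := ler_wpM2l h0 (le_trans t2 u2); lra.
Qed.

(** * The minimal solution of the resolvent equation *)

(** Jacobi iteration for [(1 + h Delta) v = f]: the equation at [x] is solved for
    the value at [x], with the previous iterate at the neighbours.  Restricting the
    [k]-th step to a finite set makes every iterate finitely supported. *)
Fixpoint iterate (h : R) (f : X -> R) (k : nat) : X -> R :=
  if k is k'.+1 then
    fun x => if x \in initseg k then
      (m x * f x + h * nbr (iterate h f k') x) / (m x + h * deg x)
    else 0
  else fun=> 0.

Definition min_sol h f x : R := lim (iterate h f k x @[k --> \oo]).

Lemma iterate_supp h f k x : x \notin initseg k -> iterate h f k x = 0.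
Proof. by case: k => // k /= /negbTE ->. Qed.

Lemma iterate_fin_supp h f k : fin_supp (iterate h f k).
Proof. by exists k; exact: iterate_supp. Qed.

Lemma nbr_iterate h f k : nbr_summable (iterate h f k).
Proof. exact/nbr_summable_fin_supp/iterate_fin_supp. Qed.

Lemma nbr_ge0 f x : (forall y, 0 <= f y) -> 0 <= nbr f x.
Proof. by move=> f0; apply: asum_ge0 => y; rewrite mulr_ge0// (graph_ge0 hb). Qed.

Lemma le_nbr f g x : nbr_summable f -> nbr_summable g ->
  (forall y, f y <= g y) -> nbr f x <= nbr g x.
Proof.
by move=> nf ng fg; apply: le_asum => // y; rewrite ler_wpM2l// (graph_ge0 hb).
Qed.

Section Iterate.
Variable h : R.
Hypothesis h_gt0 : 0 < h.
Let h_ge0 : 0 <= h := ltW h_gt0.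

Lemma denom_gt0 x : 0 < m x + h * deg x.
Proof. by rewrite ltr_pwDl// mulr_ge0// deg_ge0. Qed.

Lemma iterateS f k x : x \in initseg k.+1 ->
  (m x + h * deg x) * iterate h f k.+1 x = m x * f x + h * nbr (iterate h f k) x.
Proof. by move=> xk; rewrite /= xk mulrC divfK// gt_eqF// denom_gt0. Qed.

Lemma iterate_ge0 f k x : (forall x, 0 <= f x) -> 0 <= iterate h f k x.
Proof.
move=> f0; elim: k x => //= k ih x; case: ifP => // _.
by rewrite divr_ge0 ?(ltW (denom_gt0 x))// addr_ge0 ?mulr_ge0// nbr_ge0.
Qed.

(** The iteration is monotone in the neighbour values because [b >= 0], and a
    supersolution is not increased by one step. *)
Lemma iterate_le_super f w k x : nbr_summable w -> (forall x, 0 <= w x) ->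
  (forall x, m x * f x <= shifted h w x) -> iterate h f k x <= w x.
Proof.
move=> nw w0 fw; elim: k x => // k ih x.
have [xk|xk] := boolP (x \in initseg k.+1); last by rewrite iterate_supp.
rewrite -(ler_pM2l (denom_gt0 x)) iterateS//.
have := ler_wpM2l h_ge0 (le_nbr x (@nbr_iterate h f k) nw ih).
by have := fw x; rewrite /shifted; lra.
Qed.

Lemma iterate_step f k x : (forall x, 0 <= f x) ->
  iterate h f k x <= iterate h f k.+1 x.
Proof.
move=> f0; elim: k x => [x|k ih x]; first exact: iterate_ge0.
have [xk|xk] := boolP (x \in initseg k.+1); last first.
  by rewrite (iterate_supp _ _ xk) iterate_ge0.
have xk2 : x \in initseg k.+2 by exact: sub_initseg xk.
rewrite -(ler_pM2l (denom_gt0 x)) !iterateS// lerD2l ler_wpM2l//.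
by apply: le_nbr => //; exact: nbr_iterate.
Qed.

Lemma iterate_mono f k l x : (forall x, 0 <= f x) -> (k <= l)%N ->
  iterate h f k x <= iterate h f l x.
Proof.
move=> f0; elim: l => [|l ih]; first by rewrite leqn0 => /eqP ->.
rewrite leq_eqVlt => /predU1P[->//|]; rewrite ltnS => /ih /le_trans; apply.
exact: iterate_step.
Qed.

Lemma iterate_le f g k x : (forall x, 0 <= f x) -> (forall x, f x <= g x) ->
  iterate h f k x <= iterate h g k x.
Proof.
move=> f0 fg; elim: k x => // k ih x /=; case: ifP => // _.
rewrite ler_wpM2r ?invr_ge0 ?(ltW (denom_gt0 x))//.
apply: lerD; rewrite ler_wpM2l//.
by apply: le_nbr => //; exact: nbr_iterate.
Qed.

Lemma iterate_local f g k x : (forall x, x \in initseg k -> f x = g x) ->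
  iterate h f k x = iterate h g k x.
Proof.
elim: k x => // k ih x fg /=; case: ifP => // xk; rewrite fg//.
rewrite (_ : iterate h f k = iterate h g k)//; apply/funext => y; apply: ih.
by move=> z zk; apply: fg; exact: sub_initseg zk.
Qed.

(** The condition under which the increasing iterates converge to a real-valued
    function; it holds when there is a supersolution, or when [f] is square
    summable. *)
Definition locally_bounded f := forall x, exists M, forall k, iterate h f k x <= M.

Lemma min_sol_cvg f x : (forall x, 0 <= f x) -> locally_bounded f ->
  iterate h f k x @[k --> \oo] --> min_sol h f x.
Proof.
move=> f0 /(_ x)[M fM]; apply: nondecreasing_is_cvgn.
  by move=> k l; exact: iterate_mono.
by exists M => _ [k _ <-].
Qed.

Lemma iterate_le_min_sol f k x : (forall x, 0 <= f x) -> locally_bounded f ->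
  iterate h f k x <= min_sol h f x.
Proof.
move=> f0 lf; have c := @min_sol_cvg f x f0 lf; refine (cvgr_to_ge c _); near=> l.
by apply: iterate_mono => //; near: l; exact: nbhs_infty_ge.
Unshelve. all: by end_near. Qed.

Lemma min_sol_ge0 f x : (forall x, 0 <= f x) -> locally_bounded f ->
  0 <= min_sol h f x.
Proof. by move=> f0 lf; apply: (le_trans _ (iterate_le_min_sol 0 x f0 lf)). Qed.

Lemma min_sol_le f x (M : R) : (forall x, 0 <= f x) -> locally_bounded f ->
  (forall k, iterate h f k x <= M) -> min_sol h f x <= M.
Proof.
by move=> f0 lf fM; apply: (cvgr_to_le (@min_sol_cvg f x f0 lf)); exact: nearW.
Qed.

Lemma super_locally_bounded f w : nbr_summable w -> (forall x, 0 <= w x) ->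
  (forall x, m x * f x <= shifted h w x) -> locally_bounded f.
Proof. by move=> nw w0 fw x; exists (w x) => k; exact: iterate_le_super. Qed.

Lemma min_sol_le_super f w x : nbr_summable w -> (forall x, 0 <= w x) ->
  (forall x, 0 <= f x) -> (forall x, m x * f x <= shifted h w x) ->
  min_sol h f x <= w x.
Proof.
move=> nw w0 f0 fw; apply: min_sol_le => // [|k].
  exact: super_locally_bounded fw.
exact: iterate_le_super.
Qed.

(** The neighbour sums of the iterates increase and are bounded by the diagonal
    term of the limit, so the equation passes to the limit by dominated
    convergence. *)
Lemma min_sol_eq f : (forall x, 0 <= f x) -> locally_bounded f ->
  nbr_summable (min_sol h f) /\ forall x, shifted h (min_sol h f) x = m x * f x.
Proof.
move=> f0 lf; have s0 x := min_sol_ge0 x f0 lf.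
have cv x := @min_sol_cvg f x f0 lf.
have b0 x y : 0 <= b x y := graph_ge0 hb x y.
have cvb x y : b x y * iterate h f k y @[k --> \oo] --> b x y * min_sol h f y.
  by apply: cvgMr; exact: cv.
have ns : nbr_summable (min_sol h f).
  move=> x; pose M := (m x + h * deg x) * min_sol h f x / h.
  apply: (@abs_summable_ge0 _ _ _ M) => [y|l]; first by rewrite mulr_ge0.
  apply: (cvgr_to_le (cvg_psum_fun (k := l) (cvb x))); near=> k.
  have xk : x \in initseg k.+1.
    by rewrite mem_initseg ltnS; near: k; exact: nbhs_infty_ge.
  apply: (@le_trans _ _ (nbr (iterate h f k) x)).
    by apply: psum_le_asum => [y|]; [rewrite mulr_ge0 ?iterate_ge0|exact: nbr_iterate].
  rewrite /M ler_pdivlMr// mulrC.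
  have := ler_wpM2l (ltW (denom_gt0 x)) (iterate_le_min_sol k.+1 x f0 lf).
  by rewrite iterateS//; have := mulr_ge0 (m_ge0 x) (f0 x); lra.
split=> // x.
have cn : nbr (iterate h f k) x @[k --> \oo] --> nbr (min_sol h f) x.
  apply: (@tannery _ _ _ _ (fun y => b x y * min_sol h f y)) => // k y.
  rewrite ger0_norm ?mulr_ge0 ?iterate_ge0// ler_wpM2l//.
  exact: iterate_le_min_sol.
have c1 : (m x + h * deg x) * iterate h f k.+1 x @[k --> \oo] -->
    (m x + h * deg x) * min_sol h f x.
  apply: cvgMr; have := cv x; rewrite -(cvg_shiftS (fun k => iterate h f k x)).
  exact.
have c2 : m x * f x + h * nbr (iterate h f k) x @[k --> \oo] -->
    m x * f x + h * nbr (min_sol h f) x.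
  by apply: cvgD; [exact: cvg_cst|apply: cvgMr].
suff : (m x + h * deg x) * min_sol h f x = m x * f x + h * nbr (min_sol h f) x.
  by rewrite /shifted; lra.
suff c3 : (m x + h * deg x) * iterate h f k.+1 x @[k --> \oo] -->
    m x * f x + h * nbr (min_sol h f) x by exact: (cvg_unique _ c1 c3).
apply: cvg_trans c2; apply: near_eq_cvg; near=> k.
rewrite iterateS// mem_initseg ltnS; near: k; exact: nbhs_infty_ge.
Unshelve. all: by end_near. Qed.

Lemma shifted_iterate f k x : (forall x, 0 <= f x) -> x \in initseg k ->
  shifted h (iterate h f k) x <= m x * f x.
Proof.
case: k => [|k] f0 xk; first by move: xk; rewrite mem_initseg.
have E := iterateS f xk.
have := ler_wpM2l h_ge0 (le_nbr x (@nbr_iterate h f k) (@nbr_iterate h f k.+1)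
  (fun y => iterate_step k y f0)).
by rewrite /shifted; lra.
Qed.

(** Each iterate is a subsolution on its own support; it is tested against
    itself. *)
Lemma form_iterate_le f k : (forall x, 0 <= f x) ->
  form h (iterate h f k) (iterate h f k) <= dot m f (iterate h f k).
Proof.
move=> f0; rewrite (@green h _ _ k); first last.
- by move=> x; exact: iterate_supp.
- exact: nbr_iterate.
- exact/form_finite_fin_supp/iterate_fin_supp.
rewrite /dot (@asum_supp _ _ k); last first.
  by move=> x /(iterate_supp h f) ->; rewrite mulr0 mul0r.
rewrite /psum !big_seq; apply: ler_sum => x xk.
rewrite (mulrC (f x)) -mulrA (mulrC (f x)) ler_wpM2l ?iterate_ge0//.
exact: shifted_iterate.
Qed.

Section SquareSummableData.
Variable f : X -> R.
Hypothesis f_ge0 : forall x, 0 <= f x.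
Hypothesis f_sq : sq_summable m f.
Let it := iterate h f.
Let sol := min_sol h f.

Let it_finite k : form_finite (it k).
Proof. exact/form_finite_fin_supp/iterate_fin_supp. Qed.

Lemma dot_iterate_le k : dot m (it k) (it k) <= dot m f f.
Proof.
have [si gi] := it_finite k.
have := form_iterate_le k f_ge0; rewrite -/it /form.
have := dot_young m_ge0 f_sq si.
have := mulr_ge0 h_ge0 (dot_ge0 edge_weight_ge0 (grad (it k))); lra.
Qed.

Lemma sq_locally_bounded : locally_bounded f.
Proof.
move=> x; exists (1 + dot m f f / m x) => k.
have [si _] := it_finite k.
have := le_trans (le1_dot m_ge0 x si) (dot_iterate_le k).
rewrite -ler_pdivlMr// -/it; have := sqr_ge0 (it k x - 1).
set d := dot m f f / m x; nra.
Qed.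

Let lf := sq_locally_bounded.

Lemma sq_min_sol : sq_summable m sol /\ dot m sol sol <= dot m f f.
Proof.
apply: (@sq_summable_fatou _ _ _ m_ge0 it sol (fun=> dot m f f)).
- by move=> x; exact: min_sol_cvg.
- exact: cvg_cst.
- by move=> n; have [] := it_finite n.
- exact: dot_iterate_le.
Qed.

Let dom_it k x : `|it k x| <= sol x.
Proof. by rewrite ger0_norm ?iterate_ge0//; exact: iterate_le_min_sol. Qed.

Lemma cvg_dot_iterate g : sq_summable m g ->
  dot m g (it k) @[k --> \oo] --> dot m g sol.
Proof.
move=> sg; have [ss _] := sq_min_sol.
apply: (@tannery _ _ _ _ (fun x => `|g x * sol x * m x|)).
- exact/abs_summable_norm/(dot_summable m_ge0).
- move=> k x; rewrite !normrM ler_wpM2r// ler_wpM2l//.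
  exact: le_trans (dom_it k x) (ler_norm _).
- by move=> x; apply: cvgMl; apply: cvgMr; exact: min_sol_cvg.
Qed.

Lemma cvg_dot_iterate2 : dot m (it k) (it k) @[k --> \oo] --> dot m sol sol.
Proof.
have [ss _] := sq_min_sol.
apply: (@tannery _ _ _ _ (fun x => sol x * sol x * m x)).
- exact: (dot_summable m_ge0).
- move=> k x; rewrite !normrM (ger0_norm (m_ge0 x)) ler_wpM2r//.
  by apply: ler_pM => //; exact: dom_it.
- by move=> x; apply: cvgMl; apply: cvgM; exact: min_sol_cvg.
Qed.

(** Lower semicontinuity of the energy, with the l^2 part already convergent. *)
Lemma form_min_sol_le : form_finite sol /\ form h sol sol <= dot m f sol.
Proof.
have [ss _] := sq_min_sol.
pose M k := (dot m f (it k) - dot m (it k) (it k)) / h.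
have [gs gle] : sq_summable edge_weight (grad sol) /\
    dot edge_weight (grad sol) (grad sol) <= (dot m f sol - dot m sol sol) / h.
  apply: (@sq_summable_fatou _ _ _ edge_weight_ge0 (fun k => grad (it k)) _ M).
  - by move=> z; apply: cvgB; exact: min_sol_cvg.
  - apply: cvgMl; apply: cvgB; [exact: cvg_dot_iterate|exact: cvg_dot_iterate2].
  - by move=> k; have [] := it_finite k.
  - move=> k; rewrite ler_pdivlMr// mulrC; have := form_iterate_le k f_ge0.
    by rewrite -/it /form; lra.
split=> //; move: gle; rewrite ler_pdivlMr// mulrC /form; lra.
Qed.

Lemma form_min_sol_fin_supp phi : fin_supp phi -> form h sol phi = dot m f phi.
Proof.
move=> [k pk]; have [ns eqs] := min_sol_eq f_ge0 lf.
rewrite (green _ _ ns pk); last by have [] := form_min_sol_le.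
rewrite /dot (@asum_supp _ _ k); last by move=> x /pk ->; rewrite mulr0 mul0r.
by apply: eq_psum => x; rewrite eqs; ring.
Qed.

(** The iterates converge to the minimal solution in form norm because the
    form of the difference is at most the pairing of [f] with it. *)
Lemma dom_min_sol : dom sol.
Proof.
have [fs fle] := form_min_sol_le; apply/domP; split=> // e e0.
have H0 : 0 < 1 + h^-1 by rewrite addr_gt0 ?invr_gt0.
have d0 : 0 < e ^+ 2 / (1 + h^-1) / 2 by rewrite !divr_gt0 ?exprn_gt0.
have /cvgrPdist_le/(_ _ d0)[k _ Hk] := cvg_dot_iterate f_sq.
have {Hk} := Hk k (leqnn k); rewrite -/it -/sol => Hk.
exists (it k); first exact: iterate_fin_supp.
set g := fun x => sol x - it k x.
have fg : form_finite g by exact: form_finiteB.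
have B : form h g g <= e ^+ 2 / (1 + h^-1) / 2.
  rewrite formBB// (form_min_sol_fin_supp (iterate_fin_supp h f k)).
  have := form_iterate_le k f_ge0; rewrite -/it => Fk.
  by have := ler_norm (dot m f sol - dot m f (it k)); lra.
have a0 := dot_ge0 m_ge0 g; have b0 := dot_ge0 edge_weight_ge0 (grad g).
have hi : 0 < h^-1 by rewrite invr_gt0.
apply: (@le_lt_trans _ _ ((1 + h^-1) * form h g g)).
  rewrite /form mul1r; set u := dot m g g in a0 *; set v := dot _ _ _ in b0 *.
  have -> : (1 + h^-1) * (u + h * v) = u + h * v + h^-1 * u + v by field; rewrite gt_eqF.
  have := mulr_ge0 (ltW hi) a0; have := mulr_ge0 h_ge0 b0; lra.
apply: (le_lt_trans (ler_wpM2l (ltW H0) B)).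
have E2 : 0 < e ^+ 2 by rewrite exprn_gt0.
set H := 1 + h^-1 in H0 *; rewrite (_ : H * _ = e ^+ 2 / 2); first by lra.
by field; rewrite gt_eqF.
Qed.

Lemma weak_min_sol psi : dom psi -> form h sol psi = dot m f psi.
Proof.
apply: (weak_ext h_ge0) => //; first by have [] := form_min_sol_le.
exact: form_min_sol_fin_supp.
Qed.

End SquareSummableData.
End Iterate.

(** * The resolvent on square summable functions *)

(** The minimal solution is a monotone limit, so it is only available for
    nonnegative data; the sign is restored by splitting [f]. *)
Definition resolvent h f x : R :=
  min_sol h (fun y => Num.max (f y) 0) x - min_sol h (fun y => Num.max (- f y) 0) x.

Let pos_ge0 (f : X -> R) x : 0 <= Num.max (f x) 0.
Proof. by rewrite le_max lexx orbT. Qed.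

Let sq_pos f : sq_summable m f -> sq_summable m (fun x => Num.max (f x) 0).
Proof.
apply: (sq_summable_le m_ge0) => x; rewrite (ger0_norm (pos_ge0 f x)).
by rewrite ge_max ler_norm normr_ge0.
Qed.

Let sq_neg f : sq_summable m f -> sq_summable m (fun x => Num.max (- f x) 0).
Proof.
apply: (sq_summable_le m_ge0) => x.
rewrite (ger0_norm (pos_ge0 (fun x => - f x) x)).
by rewrite ge_max -normrN ler_norm normr_ge0.
Qed.

Section FixedResolvent.
Variable h : R.
Hypothesis h_gt0 : 0 < h.
Let h_ge0 : 0 <= h := ltW h_gt0.

Lemma dom_resolvent f : sq_summable m f -> dom (resolvent h f).
Proof.
move=> sf; apply: domB; apply: (dom_min_sol h_gt0).
- exact: pos_ge0.
- exact: sq_pos.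
- exact: (pos_ge0 (fun x => - f x)).
- exact: sq_neg.
Qed.

Lemma sq_resolvent f : sq_summable m f -> sq_summable m (resolvent h f).
Proof. by move=> /dom_resolvent/dom_finite[]. Qed.

Lemma weak_resolvent f psi : sq_summable m f -> dom psi ->
  form h (resolvent h f) psi = dot m f psi.
Proof.
move=> sf dpsi; have sp := sq_pos sf; have sn := sq_neg sf.
have n0 := pos_ge0 (fun x => - f x).
have [spsi _] := dom_finite dpsi.
rewrite formB; first last.
- exact: dom_finite.
- exact/dom_finite/(dom_min_sol h_gt0 n0 sn).
- exact/dom_finite/(dom_min_sol h_gt0 (pos_ge0 f) sp).
rewrite (weak_min_sol h_gt0 (pos_ge0 f) sp)// (weak_min_sol h_gt0 n0 sn)//.
have <- := dotBl m_ge0 sp sn spsi; congr (dot m _ psi); apply/funext => x.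
by rewrite !maxEle; do 2 case: ifPn => //; rewrite -?ltNge; lra.
Qed.

(** The form of the difference of two weak solutions vanishes. *)
Lemma resolvent_unique f v : sq_summable m f -> dom v ->
  (forall psi, dom psi -> form h v psi = dot m f psi) -> v = resolvent h f.
Proof.
move=> sf dv weak; have dr := dom_resolvent sf.
have dd := domB dv dr; have [sd _] := dom_finite dd.
have : form h (fun x => v x - resolvent h f x) (fun x => v x - resolvent h f x) = 0.
  by rewrite formB ?weak ?weak_resolvent ?subrr//; exact: dom_finite.
set d := fun x => v x - _.
have := dot_ge0 m_ge0 d; have := mulr_ge0 h_ge0 (dot_ge0 edge_weight_ge0 (grad d)).
rewrite /form => g0 d0 E.
have {}E : dot m d d = 0 by lra.
by apply/funext => x; apply/eqP; rewrite -subr_eq0; apply/eqP/(dot_eq0 m_ge0 (m_gt0 x) sd E).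
Qed.

Lemma resolvent_ge0E f : sq_summable m f -> (forall x, 0 <= f x) ->
  resolvent h f = min_sol h f.
Proof.
move=> sf f0; symmetry; apply: resolvent_unique => //.
  exact: (dom_min_sol h_gt0).
by move=> psi; exact: (weak_min_sol h_gt0).
Qed.

Lemma resolvent_lin a f g : sq_summable m f -> sq_summable m g ->
  resolvent h (fun x => a * f x + g x) =
  fun x => a * resolvent h f x + resolvent h g x.
Proof.
move=> sf sg; have sa := sq_summableZ a sf.
symmetry; apply: resolvent_unique.
- exact: (sq_summableD m_ge0).
- by apply: dom_lin; exact: dom_resolvent.
move=> psi dpsi; have [spsi _] := dom_finite dpsi.
have ff := dom_finite (dom_resolvent sf); have fg := dom_finite (dom_resolvent sg).
rewrite (form_lin h a ff fg (dom_finite dpsi)) (weak_resolvent sf dpsi).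
by rewrite (weak_resolvent sg dpsi) (dotDl m_ge0 sa sg spsi) (dotZl m_ge0).
Qed.

Lemma resolventB f g : sq_summable m f -> sq_summable m g ->
  resolvent h (fun x => f x - g x) = fun x => resolvent h f x - resolvent h g x.
Proof.
move=> sf sg; have := resolvent_lin (-1) sg sf.
under [X in resolvent h X]eq_fun do rewrite mulN1r addrC.
by move=> ->; apply/funext => x; rewrite mulN1r addrC.
Qed.

Lemma resolvent_ge0 f x : sq_summable m f -> (forall x, 0 <= f x) ->
  0 <= resolvent h f x.
Proof.
move=> sf f0; rewrite resolvent_ge0E//; apply: min_sol_ge0 => //.
exact: sq_locally_bounded.
Qed.

Lemma resolvent_le f g x : sq_summable m f -> sq_summable m g ->
  (forall x, f x <= g x) -> resolvent h f x <= resolvent h g x.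
Proof.
move=> sf sg fg; rewrite -subr_ge0.
have := @resolvent_ge0 (fun x => g x - f x) x; rewrite resolventB//; apply.
  exact: (sq_summableB m_ge0).
by move=> y; rewrite subr_ge0.
Qed.

Lemma resolvent_le_super f w x : sq_summable m f -> nbr_summable w ->
  (forall x, 0 <= w x) -> (forall x, 0 <= f x) ->
  (forall x, m x * f x <= shifted h w x) -> resolvent h f x <= w x.
Proof. by move=> sf *; rewrite resolvent_ge0E//; exact: min_sol_le_super. Qed.

(** At a vertex the diagonal part of the operator alone gives a lower bound. *)
Lemma min_sol_ge f x : (forall x, 0 <= f x) -> locally_bounded h f ->
  m x * f x <= (m x + h * deg x) * min_sol h f x.
Proof.
move=> f0 lf; have [ns <-] := min_sol_eq h_gt0 f0 lf; rewrite /shifted.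
have : 0 <= nbr (min_sol h f) x by apply: nbr_ge0 => y; exact: min_sol_ge0.
by move=> /(mulr_ge0 h_ge0); lra.
Qed.

Lemma norm2_resolvent f : sq_summable m f -> norm2 m (resolvent h f) <= norm2 m f.
Proof.
move=> sf; have df := dom_resolvent sf; have sr := sq_resolvent sf.
have := weak_resolvent sf df; rewrite /form -(sqr_norm2 m_ge0) => E.
have := ler_dot m_ge0 sf sr; have := ler_norm (dot m f (resolvent h f)).
have := mulr_ge0 h_ge0 (dot_ge0 edge_weight_ge0 (grad (resolvent h f))).
have := norm2_ge0 m (resolvent h f); rewrite le_eqVlt => /predU1P[<- *|p g0 l1 l2].
  exact: norm2_ge0.
by rewrite -(ler_pM2r p); move: E; rewrite expr2; lra.
Qed.

Lemma resolvent_sym f g : sq_summable m f -> sq_summable m g ->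
  dot m (resolvent h f) g = dot m f (resolvent h g).
Proof.
move=> sf sg; rewrite (dotC m _ g) -(weak_resolvent sg (dom_resolvent sf)) formC.
exact: (weak_resolvent sf (dom_resolvent sg)).
Qed.

(** This lemma and the next say that the resolvent inverts [1 + h L]. *)
Lemma dirichlet_laplacian_resolvent f : sq_summable m f ->
  dirichlet_laplacian m b (resolvent h f) (fun x => h^-1 * (f x - resolvent h f x)).
Proof.
move=> sf; have sr := sq_resolvent sf; have sd := sq_summableB m_ge0 sf sr.
have dr := dom_resolvent sf.
split=> [//||psi dpsi]; first exact/lp2E/sq_summableZ.
have [spsi gpsi] := dom_finite dpsi; have [_ gr] := dom_finite dr.
rewrite (energy_dotE gr gpsi) l2dotE (dotZl m_ge0 _ sd spsi) (dotBl m_ge0 sf sr spsi).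
by rewrite -(weak_resolvent sf dpsi) /form addrC addKr mulKf// gt_eqF.
Qed.

Lemma resolvent_of_laplacian v g : dirichlet_laplacian m b v g ->
  resolvent h (fun x => v x + h * g x) = v.
Proof.
move=> [dv /lp2E sg weak]; have [sv gv] := dom_finite dv.
have shg := sq_summableZ h sg.
symmetry; apply: resolvent_unique => //; first exact: (sq_summableD m_ge0).
move=> psi dpsi; have [spsi gpsi] := dom_finite dpsi.
rewrite (dotDl m_ge0 sv shg spsi) (dotZl m_ge0 _ sg spsi) -(l2dotE g psi) -(weak _ dpsi).
by rewrite (energy_dotE gv gpsi).
Qed.

(** The resolvent minimizes [|v - g|^2 + h Q(v)], and [v = g] is a competitor. *)
Lemma resolvent_energy g : dom g ->
  dot m (fun x => resolvent h g x - g x) (fun x => resolvent h g x - g x) <=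
  h * dot edge_weight (grad g) (grad g).
Proof.
move=> dg; have [sg gg] := dom_finite dg; have dr := dom_resolvent sg.
have [sr gr] := dom_finite dr.
have E1 := weak_resolvent sg dr; have E2 := weak_resolvent sg dg.
rewrite (dotBB m_ge0)//; move: E1 E2; rewrite /form.
rewrite (dotC m g (resolvent h g)) => E1 E2.
have Y := dot_young edge_weight_ge0 gr gg.
have := ler_wpM2l h_ge0 Y; have := mulr_ge0 h_ge0 (dot_ge0 edge_weight_ge0 (grad g)).
have := mulr_ge0 h_ge0 (dot_ge0 edge_weight_ge0 (grad (resolvent h g))); lra.
Qed.

End FixedResolvent.

Lemma fin_supp_dense g e : sq_summable m g -> 0 < e ->
  exists2 phi, fin_supp phi & norm2 m (fun x => g x - phi x) <= e.
Proof.
move=> sg e0.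
have /cvgrPdist_le/(_ _ (exprn_gt0 2 e0))[k _ Hk] := cvg_psum sg.
have {}Hk := Hk k (leqnn k).
pose phi x := if x \in initseg k then g x else 0.
have fk x : x \notin initseg k -> phi x = 0 by rewrite /phi => /negbTE ->.
exists phi; first by exists k.
have sphi : sq_summable m phi by apply: sq_fin_supp; exists k.
rewrite (norm2_le m_ge0) ?(ltW e0)// (dotBB m_ge0)//.
have E f : (forall x, x \in initseg k -> f x * phi x = g x ^+ 2) ->
    dot m f phi = psum k (fun x => g x ^+ 2 * m x).
  move=> fE; rewrite /dot (@asum_supp _ _ k); last by move=> x /fk ->; rewrite mulr0 mul0r.
  by rewrite /psum !big_seq; apply: eq_bigr => x /fE ->.
rewrite !E; try by move=> x xk; rewrite /phi xk expr2.
rewrite /dot; under eq_asum do rewrite -expr2.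
apply: le_trans Hk; apply: le_trans (ler_norm _); lra.
Qed.

(** For functions in the form domain this is the previous energy bound; the
    general case follows by density since resolvents are contractions. *)
Lemma resolvent_continuous g e : sq_summable m g -> 0 < e ->
  exists2 d, 0 < d & forall h, 0 < h -> h <= d ->
    norm2 m (fun x => resolvent h g x - g x) <= e.
Proof.
move=> sg e0; have e3 : 0 < e / 3 by rewrite divr_gt0.
have [phi fphi hphi] := fin_supp_dense sg e3.
have sphi := sq_fin_supp fphi; have dphi := dom_fin_supp fphi.
set D := dot edge_weight (grad phi) (grad phi).
have D0 : 0 <= D := dot_ge0 edge_weight_ge0 _.
have D1 : 0 < D + 1 by rewrite ltr_wpDl.
exists ((e / 3) ^+ 2 / (D + 1)); first by rewrite divr_gt0 ?exprn_gt0.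
move=> h h0; rewrite ler_pdivlMr// => hd.
have sr := sq_resolvent h0 sg; have srp := sq_resolvent h0 sphi.
have sgp := sq_summableB m_ge0 sg sphi.
rewrite (_ : (fun x => _) = fun x => (resolvent h (fun y => g y - phi y) x +
  (resolvent h phi x - phi x)) - (g x - phi x)); last first.
  by apply/funext => x; rewrite resolventB//; ring.
have s1 := sq_resolvent h0 sgp; have s2 := sq_summableB m_ge0 srp sphi.
apply: le_trans (norm2B m_ge0 (sq_summableD m_ge0 s1 s2) sgp) _.
apply: le_trans (lerD (norm2D m_ge0 s1 s2) (lexx _)) _.
have n1 := le_trans (norm2_resolvent h0 sgp) hphi.
suff : norm2 m (fun x => resolvent h phi x - phi x) <= e / 3 by lra.
rewrite (norm2_le m_ge0) ?(ltW e3)//.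
apply: le_trans (resolvent_energy h0 dphi) _; rewrite -/D.
apply: le_trans hd; lra.
Qed.

(** * The exponential formula *)

Lemma sq_iter_resolvent h f n : 0 < h -> sq_summable m f ->
  sq_summable m (iter n (resolvent h) f).
Proof. by move=> h0 sf; elim: n => //= n ih; exact: sq_resolvent. Qed.

Lemma norm2_iter_resolvent h f n : 0 < h -> sq_summable m f ->
  norm2 m (iter n (resolvent h) f) <= norm2 m f.
Proof.
move=> h0 sf; elim: n => //= n; apply: le_trans; apply: norm2_resolvent => //.
exact: sq_iter_resolvent.
Qed.

Lemma iter_resolventB h f g n : 0 < h -> sq_summable m f -> sq_summable m g ->
  iter n (resolvent h) (fun x => f x - g x) =
  fun x => iter n (resolvent h) f x - iter n (resolvent h) g x.
Proof.
by move=> h0 sf sg; elim: n => //= n ->; rewrite resolventB//; exact: sq_iter_resolvent.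
Qed.

Lemma norm2_pointwise F x e : sq_summable m F -> 0 <= e ->
  norm2 m F <= e * Num.sqrt (m x) -> `|F x| <= e.
Proof.
move=> sF e0; rewrite (norm2_le m_ge0) ?mulr_ge0 ?sqrtr_ge0// exprMn sqr_sqrtr//.
move=> /(le_trans (le1_dot m_ge0 x sF)); rewrite ler_pM2r//.
by rewrite -(real_normK (num_real (F x))) ler_sqr ?nnegrE.
Qed.

(** Translates extended real convergence at 0+ to estimates for norms. *)
Lemma cvg_lp_pow0P (F : R -> X -> R) : (forall t, 0 < t -> sq_summable m (F t)) ->
  lp_pow m 2 (F t) @[t --> 0^'+] --> 0%E <->
  forall e, 0 < e -> exists2 d, 0 < d &
    forall t, 0 < t -> t < d -> norm2 m (F t) <= e.
Proof.
move=> sF; split=> [/fine_cvgP[_ /cvgrPdist_lt c] e e0|c].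
  have /nbhs_ballP[d /= d0 hd] := c _ (exprn_gt0 2 e0).
  exists d => // t t0 td; rewrite (norm2_le m_ge0) ?(ltW e0)//.
  have /(_ _ t0) := hd t; rewrite /ball /= sub0r normrN gtr0_norm// => /(_ td).
  rewrite (lp_powE (sF _ t0)) => hF.
  have {}hF : `|0 - dot m (F t) (F t)| <= e ^+ 2 := ltW hF.
  by rewrite sub0r normrN in hF; exact: le_trans (ler_norm _) hF.
apply/fine_cvgP; split.
  near=> t; rewrite lp_powE//; apply: sF; near: t; exact: nbhs_right_gt.
apply/cvgrPdist_lt => e e0.
pose r := Num.min 1 (e / 2).
have r0 : 0 < r by rewrite lt_min ltr01 divr_gt0.
have [d d0 hd] := c _ r0.
near=> t.
have t0 : 0 < t by near: t; exact: nbhs_right_gt.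
have td : t < d by near: t; exact: nbhs_right_lt.
rewrite /= (lp_powE (sF _ t0)) /=.
have -> : `|0 - dot m (F t) (F t)| = dot m (F t) (F t).
  by rewrite sub0r normrN ger0_norm// (dot_ge0 m_ge0).
have := hd _ t0 td; rewrite (norm2_le m_ge0) ?(ltW r0)// => /le_lt_trans; apply.
have r1 : r <= 1 by rewrite ge_min lexx.
have r2 : r <= e / 2 by rewrite ge_min lexx orbT.
have : r ^+ 2 <= r by rewrite expr2 ler_piMl// ltW.
lra.
Unshelve. all: by end_near. Qed.

Section Semigroup.
Variable P : R -> (X -> R) -> X -> R.
Hypothesis hP : is_dirichlet_semigroup m b P.

Lemma sq_semigroup t f : 0 <= t -> sq_summable m f -> sq_summable m (P t f).
Proof.
move=> t0 /lp2E lf; apply/lp2E.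
exact: (le_lt_trans (semigroup_contraction hP t0 lf) lf).
Qed.

Lemma norm2_semigroup t f : 0 <= t -> sq_summable m f ->
  norm2 m (P t f) <= norm2 m f.
Proof.
move=> t0 sf; have sP := sq_semigroup t0 sf.
have := semigroup_contraction hP t0 ((lp2E f).2 sf).
by rewrite !lp_powE// lee_fin; exact: ler_wsqrtr.
Qed.

Lemma semigroup_lin t a f g : 0 <= t -> sq_summable m f -> sq_summable m g ->
  P t (fun x => a * f x + g x) = fun x => a * P t f x + P t g x.
Proof.
move=> t0 /lp2E lf /lp2E lg; apply/funext => x.
exact: (semigroup_linear hP).
Qed.

Lemma semigroupB t f g : 0 <= t -> sq_summable m f -> sq_summable m g ->
  P t (fun x => f x - g x) = fun x => P t f x - P t g x.
Proof.
move=> t0 sf sg; have := semigroup_lin (-1) t0 sg sf.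
under [X in P t X]eq_fun do rewrite mulN1r addrC.
by move=> ->; apply/funext => x; rewrite mulN1r addrC.
Qed.

Lemma semigroupZ t a f : 0 <= t -> sq_summable m f ->
  P t (fun x => a * f x) = fun x => a * P t f x.
Proof.
move=> t0 sf; have s0 := sq_summableB m_ge0 sf sf.
have := semigroup_lin a t0 sf s0; rewrite semigroupB//.
under [X in P t X]eq_fun do rewrite subrr addr0.
by move=> ->; apply/funext => x; rewrite subrr addr0.
Qed.

Let sq_quot t f g : 0 < t -> sq_summable m f -> sq_summable m g ->
  sq_summable m (fun x => t^-1 * (f x - P t f x) - g x).
Proof.
move=> t0 sf sg; have sP := sq_semigroup (ltW t0) sf.
apply: (sq_summableB m_ge0) => //; apply: sq_summableZ.
exact: (sq_summableB m_ge0).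
Qed.

Lemma generator_quotP f g : sq_summable m f -> sq_summable m g ->
  dirichlet_laplacian m b f g <->
  forall e, 0 < e -> exists2 d, 0 < d & forall t, 0 < t -> t < d ->
    norm2 m (fun x => t^-1 * (f x - P t f x) - g x) <= e.
Proof.
move=> sf sg; apply: iff_trans (cvg_lp_pow0P _).
  exact: (semigroup_generator hP ((lp2E f).2 sf) ((lp2E g).2 sg)).
by move=> t t0; exact: sq_quot.
Qed.

Lemma semigroupC s t f : 0 <= s -> 0 <= t -> sq_summable m f ->
  P s (P t f) = P t (P s f).
Proof.
by move=> s0 t0 /lp2E lf; rewrite -!(semigroup_add hP)// addrC.
Qed.

(** The difference quotients of [P s v] are the images under [P s] of those of
    [v], and [P s] is a contraction. *)
Lemma semigroup_laplacian s v g : 0 <= s -> dirichlet_laplacian m b v g ->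
  dirichlet_laplacian m b (P s v) (P s g).
Proof.
move=> s0 L; have [/dom_finite[sv _] /lp2E sg _] := L.
have sPv := sq_semigroup s0 sv; have sPg := sq_semigroup s0 sg.
apply/generator_quotP => // e e0.
have [d d0 hd] := (generator_quotP sv sg).1 L _ e0.
exists d => // t t0 td; apply: le_trans (hd _ t0 td).
have sPt := sq_semigroup (ltW t0) sv.
have sq := sq_summableB m_ge0 sv sPt.
rewrite (_ : (fun x => _) = P s (fun x => t^-1 * (v x - P t v x) - g x)).
  by apply: norm2_semigroup => //; exact: sq_quot.
rewrite semigroupB ?semigroupZ ?semigroupB//; last exact: sq_summableZ.
by rewrite (semigroupC s0 (ltW t0)).
Qed.

Lemma semigroup_resolvent s h f : 0 <= s -> 0 < h -> sq_summable m f ->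
  P s (resolvent h f) = resolvent h (P s f).
Proof.
move=> s0 h0 sf; have sr := sq_resolvent h0 sf.
have L := semigroup_laplacian s0 (dirichlet_laplacian_resolvent h0 sf).
rewrite -{1}(resolvent_of_laplacian h0 L); congr resolvent; apply/funext => x.
have sd := sq_summableB m_ge0 sf sr.
rewrite semigroupZ// semigroupB// mulVKf ?gt_eqF//; ring.
Qed.

Let nat_time (n : nat) (h : R) : 0 < h -> 0 <= n%:R * h.
Proof. by move=> h0; rewrite mulr_ge0 ?ler0n ?ltW. Qed.

(** Telescoping: one step errors add up, since both families are contractions
    and commute. *)
Lemma semigroup_iter_resolvent h f n : 0 < h -> sq_summable m f ->
  norm2 m (fun x => P (n%:R * h) f x - iter n (resolvent h) f x) <=
  n%:R * norm2 m (fun x => P h f x - resolvent h f x).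
Proof.
move=> h0 sf; have h1 := ltW h0; have sr := sq_resolvent h0 sf.
have sP := sq_semigroup h1 sf.
elim: n => [|n ih].
  rewrite !mul0r (semigroup_id hP)/= ?lp2E//.
  rewrite (norm2_le m_ge0)// expr0n /dot /=.
  rewrite (_ : asum _ = 0)// -[RHS](@asum0 R X); apply: eq_asum => x.
  by rewrite subrr !mul0r.
have n0 := nat_time n h0.
have sPn := sq_semigroup n0 sf; have sI := sq_iter_resolvent n h0 sf.
rewrite (_ : (fun x => _) = fun x =>
    P (n%:R * h) (fun y => P h f y - resolvent h f y) x +
    resolvent h (fun y => P (n%:R * h) f y - iter n (resolvent h) f y) x).
  have sD := sq_summableB m_ge0 sP sr.
  have sE := sq_summableB m_ge0 sPn sI.
  apply: le_trans (norm2D m_ge0 (sq_semigroup n0 sD) (sq_resolvent h0 sE)) _.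
  have := norm2_semigroup n0 sD; have := norm2_resolvent h0 sE.
  rewrite -[n.+1]addn1 natrD mulrDl mul1r; lra.
rewrite -[n.+1]addn1 natrD mulrDl mul1r (semigroup_add hP)// ?lp2E//.
rewrite addn1 semigroupB// resolventB// -semigroup_resolvent//=.
by apply/funext => x; ring.
Qed.

(** Both [P_h f] and [J_h f] agree with [f - h L f] up to [o(h)]. *)
Lemma step_error f g e : dirichlet_laplacian m b f g -> 0 < e ->
  exists2 d, 0 < d & forall h, 0 < h -> h < d ->
    norm2 m (fun x => P h f x - resolvent h f x) <= h * e.
Proof.
move=> L e0; have [/dom_finite[sf _] /lp2E sg _] := L.
have e2 : 0 < e / 2 by rewrite divr_gt0.
have [d d0 hd] := (generator_quotP sf sg).1 L _ e2.
have [d' d'0 hd'] := resolvent_continuous sg e2.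
exists (Num.min d d'); first by rewrite lt_min d0.
move=> h h0; rewrite lt_min => /andP[hd1 /ltW hd2].
have {hd}hd := hd _ h0 hd1; have {hd'}hd' := hd' _ h0 hd2.
have sq := sq_quot h0 sf sg; have sr := sq_resolvent h0 sg.
have sB := sq_summableB m_ge0 sr sg.
have shg := sq_summableZ h sg.
have E : f = fun x => resolvent h f x + h * resolvent h g x.
  rewrite -{1}(resolvent_of_laplacian h0 L).
  under eq_fun do rewrite addrC.
  by rewrite resolvent_lin//; apply/funext => x; rewrite addrC.
rewrite (_ : (fun x => _) = fun x => h *
    ((resolvent h g x - g x) - (h^-1 * (f x - P h f x) - g x))).
  rewrite (norm2Z m_ge0); last exact: (sq_summableB m_ge0).
  rewrite gtr0_norm// ler_pM2l//.
  by apply: le_trans (norm2B m_ge0 sB sq) _; lra.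
apply/funext => x; have := congr1 (fun F => F x) E => /= Ex.
have : h * (h^-1 * (f x - P h f x)) = f x - P h f x by rewrite mulVKf ?gt_eqF.
set q := h^-1 * _; lra.
Qed.

Let exponential_formula_laplacian T f g e : 0 < T ->
  dirichlet_laplacian m b f g -> 0 < e ->
  exists N, forall n, (N <= n)%N ->
    norm2 m (fun x => P T f x - iter n.+1 (resolvent (T / n.+1%:R)) f x) <= e.
Proof.
move=> T0 L e0; have [/dom_finite[sf _] _ _] := L.
have [d d0 hd] := step_error L (divr_gt0 e0 T0).
exists (Num.truncn (T / d)) => n Nn.
have n0 : (0 : R) < n.+1%:R by rewrite ltr0n.
have h0 : 0 < T / n.+1%:R by rewrite divr_gt0.
have hlt : T / n.+1%:R < d.
  rewrite ltr_pdivrMr// mulrC -ltr_pdivrMr//.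
  apply: lt_le_trans (truncnS_gt _) _; by rewrite ler_nat.
have := semigroup_iter_resolvent n.+1 h0 sf.
rewrite {1}(mulrC n.+1%:R) divfK ?gt_eqF// => /le_trans; apply.
apply: le_trans (ler_wpM2l (ltW n0) (hd _ h0 hlt)) _.
rewrite mulrA (mulrC n.+1%:R) divfK ?gt_eqF// mulrC divfK ?gt_eqF//.
Qed.

(** Both sides are contractions, so the formula extends from the operator
    domain to all of l^2. *)
Lemma exponential_formula T f x : 0 < T -> sq_summable m f ->
  iter n.+1 (resolvent (T / n.+1%:R)) f x @[n --> \oo] --> P T f x.
Proof.
move=> T0 sf; apply/cvgrPdist_le => e e0.
have mx : 0 < Num.sqrt (m x) by rewrite sqrtr_gt0.
have e3 : 0 < e * Num.sqrt (m x) / 3 by rewrite divr_gt0// mulr_gt0.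
have [d d0 hd] := resolvent_continuous sf e3.
have {hd}hd := hd _ d0 (lexx d).
have sr := sq_resolvent d0 sf.
have [N hN] := exponential_formula_laplacian T0 (dirichlet_laplacian_resolvent d0 sf) e3.
near=> n.
have Nn : (N <= n)%N by near: n; exact: nbhs_infty_ge.
have {}hN := hN n Nn.
have h0 : 0 < T / n.+1%:R by rewrite divr_gt0.
pose I := iter n.+1 (resolvent (T / n.+1%:R)).
have sPf := sq_semigroup (ltW T0) sf; have sIf := sq_iter_resolvent n.+1 h0 sf.
have sPr := sq_semigroup (ltW T0) sr; have sIr := sq_iter_resolvent n.+1 h0 sr.
have sD := sq_summableB m_ge0 sr sf.
have sPD := sq_semigroup (ltW T0) sD; have sID := sq_iter_resolvent n.+1 h0 sD.
have sM := sq_summableB m_ge0 sPr sIr.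
apply: (@norm2_pointwise (fun x => P T f x - I f x)).
- exact: (sq_summableB m_ge0).
- exact: ltW.
rewrite (_ : (fun x => _) = fun x => (P T (resolvent d f) x - I (resolvent d f) x) +
   (I (fun y => resolvent d f y - f y) x) - P T (fun y => resolvent d f y - f y) x).
  apply: le_trans (norm2B m_ge0 (sq_summableD m_ge0 sM sID) sPD) _.
  apply: le_trans (lerD (norm2D m_ge0 sM sID) (lexx _)) _.
  have := norm2_semigroup (ltW T0) sD; have := norm2_iter_resolvent n.+1 h0 sD.
  move: hN hd; rewrite -/I; lra.
apply/funext => y; rewrite /I iter_resolventB// semigroupB//; last exact: ltW.
by ring.
Unshelve. all: by end_near. Qed.

(** * Order properties of the semigroup *)

Lemma iter_resolvent_ge0 h f n x : 0 < h -> sq_summable m f ->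
  (forall x, 0 <= f x) -> 0 <= iter n (resolvent h) f x.
Proof.
move=> h0 sf f0; elim: n x => //= n ih x; apply: resolvent_ge0 => //.
exact: sq_iter_resolvent.
Qed.

Lemma semigroup_ge0 T f x : 0 < T -> sq_summable m f -> (forall x, 0 <= f x) ->
  0 <= P T f x.
Proof.
move=> T0 sf f0; apply: (cvgr_to_ge (@exponential_formula T f x T0 sf)).
by apply: nearW => n; apply: iter_resolvent_ge0 => //; rewrite divr_gt0.
Qed.

Lemma nbr_summable_cst (c : R) : nbr_summable (fun=> c).
Proof.
by move=> x; apply: abs_summable_eq (abs_summableZ c (b_summable x)) => y; rewrite mulrC.
Qed.

Lemma shifted_cst h c x : shifted h (fun=> c) x = m x * c.
Proof.
rewrite /shifted /nbr (_ : asum _ = c * deg x); first by ring.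
rewrite -asumZ; last exact: b_summable.
by apply: eq_asum => y; rewrite mulrC.
Qed.

Lemma nbr_summable_lin a f g : nbr_summable f -> nbr_summable g ->
  nbr_summable (fun x => a * f x + g x).
Proof.
move=> nf ng x; apply: abs_summable_eq (abs_summableD (abs_summableZ a (nf x)) (ng x)) => y.
by ring.
Qed.

Lemma shifted_lin h a f g x : nbr_summable f -> nbr_summable g ->
  shifted h (fun x => a * f x + g x) x = a * shifted h f x + shifted h g x.
Proof.
move=> nf ng; rewrite /shifted.
have -> : nbr (fun x => a * f x + g x) x = a * nbr f x + nbr g x.
  rewrite /nbr -asumZ// -asumD//; last exact: abs_summableZ.
  by apply: eq_asum => y; ring.
by ring.
Qed.

Lemma resolvent_le_cst h f c x : 0 < h -> sq_summable m f ->
  (forall x, 0 <= f x) -> (forall x, f x <= c) -> resolvent h f x <= c.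
Proof.
move=> h0 sf f0 fc; apply: (@resolvent_le_super _ h0 _ (fun=> c)) => //.
- exact: nbr_summable_cst.
- by move=> y; exact: le_trans (f0 y) (fc y).
- by move=> y; rewrite shifted_cst ler_wpM2l.
Qed.

Lemma semigroup_le_cst T f c x : 0 < T -> sq_summable m f ->
  (forall x, 0 <= f x) -> (forall x, f x <= c) -> P T f x <= c.
Proof.
move=> T0 sf f0 fc; apply: (cvgr_to_le (@exponential_formula T f x T0 sf)).
apply: nearW => n; have : 0 < T / n.+1%:R by rewrite divr_gt0.
move: (T / _) => h h0; elim: n.+1 x => //= k ih x; apply: resolvent_le_cst => //.
  exact: sq_iter_resolvent.
by move=> y; exact: iter_resolvent_ge0.
Qed.

Definition trunc k (f : X -> R) x := if x \in initseg k then f x else 0.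

Lemma trunc_out k f x : x \notin initseg k -> trunc k f x = 0.
Proof. by rewrite /trunc => /negbTE ->. Qed.

Lemma sq_trunc k f : sq_summable m (trunc k f).
Proof. by apply: sq_fin_supp; exists k; exact: trunc_out. Qed.

Lemma trunc_ge0 k f x : (forall x, 0 <= f x) -> 0 <= trunc k f x.
Proof. by rewrite /trunc => f0; case: ifP. Qed.

Lemma trunc_le k f x : (forall x, 0 <= f x) -> trunc k f x <= f x.
Proof. by rewrite /trunc => f0; case: ifP. Qed.

Lemma cvg_trunc f x : trunc k f x @[k --> \oo] --> f x.
Proof.
apply: cvg_near_cst; near=> k; rewrite /trunc mem_initseg ifT//.
near: k; exact: nbhs_infty_gt.
Unshelve. all: by end_near. Qed.

Lemma sq_delta y : sq_summable m (delta y).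
Proof.
have [k yk] := initseg_seq [:: y].
apply: sq_fin_supp; exists k => x; rewrite /delta; case: eqP => // ->.
by rewrite yk// inE.
Qed.

Lemma delta_ge0 y x : 0 <= delta y x. Proof. exact: ler0n. Qed.
Lemma delta_le1 y x : delta y x <= 1. Proof. by rewrite lern1 leq_b1. Qed.

Lemma semigroup_trunc T k f x : 0 <= T ->
  P T (trunc k f) x = psum k (fun y => f y * P T (delta y) x).
Proof.
move=> T0.
have H (s : seq X) c : sq_summable m (fun x => \sum_(y <- s) c y * delta y x) /\
    P T (fun x => \sum_(y <- s) c y * delta y x) =
    fun x => \sum_(y <- s) c y * P T (delta y) x.
  elim: s => [|y s [ss ih]].
    have E : (fun x : X => \sum_(y <- [::]) c y * delta y x) = fun z => 0 * delta x z.
      by apply/funext => z; rewrite big_nil mul0r.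
    have s0 := sq_delta x.
    rewrite E; split; first exact: sq_summableZ.
    by rewrite semigroupZ//; apply/funext => z; rewrite big_nil mul0r.
  have E : (fun x => \sum_(z <- y :: s) c z * delta z x) =
      fun x => c y * delta y x + \sum_(y <- s) c y * delta y x.
    by apply/funext => z; rewrite big_cons.
  have sd := sq_delta y; rewrite E; split.
    by apply: (sq_summableD m_ge0) => //; exact: sq_summableZ.
  by rewrite semigroup_lin// ih; apply/funext => z; rewrite big_cons.
rewrite (fin_supp_sum (fun y => @trunc_out k f y)) (H _ _).2.
by rewrite /psum !big_seq; apply: eq_bigr => y yk; rewrite /trunc yk.
Qed.

Lemma psum_semigroup_delta_le1 T k x : 0 < T ->
  psum k (fun y => P T (delta y) x) <= 1.
Proof.
move=> T0; have := @semigroup_trunc T k (fun=> 1) x (ltW T0).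
under [X in _ = X]eq_psum do rewrite mul1r.
move=> <-; apply: semigroup_le_cst => //; first exact: sq_trunc.
  by move=> y; apply: trunc_ge0.
by move=> y; apply: (@trunc_le k (fun=> 1)).
Qed.

(** * Stochastic completeness: the resolvent preserves constants *)

Section StochasticCompleteness.
Hypothesis hSC : stochastically_complete m P.
Variable h : R.
Hypothesis h_gt0 : 0 < h.

Let one : X -> R := fun=> 1.
Let one_ge0 x : 0 <= one x := ler01.

Lemma one_locally_bounded : locally_bounded h one.
Proof.
apply: (@super_locally_bounded _ h_gt0 _ one) => //.
  exact: nbr_summable_cst.
by move=> x; rewrite shifted_cst.
Qed.

Let s := min_sol h one.
Let w x := 1 - s x.

Let s_ge0 x : 0 <= s x.
Proof. exact: (min_sol_ge0 h_gt0 x one_ge0 one_locally_bounded). Qed.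

Let s_le1 x : s x <= 1.
Proof.
apply: (@min_sol_le_super _ h_gt0 _ one) => //.
  exact: nbr_summable_cst.
by move=> y; rewrite shifted_cst.
Qed.

Let w_ge0 x : 0 <= w x. Proof. by rewrite subr_ge0. Qed.
Let w_le1 x : w x <= 1. Proof. by rewrite lerBlDr lerDl. Qed.

(** [1 - a w] is a supersolution with a strictly smaller multiple of [w] on the
    right-hand side, so that each resolvent step gains a factor. *)
Let resolvent_step mu a f x : 0 < mu -> mu < h -> 0 <= a -> a <= 1 ->
  sq_summable m f -> (forall x, 0 <= f x) ->
  (forall x, f x <= 1 - a * (1 - mu / h) * w x) ->
  resolvent mu f x <= 1 - a * w x.
Proof.
move=> mu0 muh a0 a1 sf f0 fw.
have [ns eqs] := min_sol_eq h_gt0 one_ge0 one_locally_bounded.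
have E : (fun x => 1 - a * w x) = fun x => a * s x + (1 - a).
  by apply/funext => y; rewrite /w; ring.
apply: (@resolvent_le_super _ mu0 _ (fun x => 1 - a * w x)) => //.
- by rewrite E; apply: nbr_summable_lin => //; exact: nbr_summable_cst.
- by move=> y; rewrite subr_ge0; apply: mulr_ile1.
move=> y; rewrite E shifted_lin//; last exact: nbr_summable_cst.
rewrite shifted_cst; have := eqs y; rewrite -/s /shifted mulr1.
set L := deg y * _ - _ => e.
have hL : L = m y * w y / h.
  have hLw : h * L = m y * w y by rewrite /w; lra.
  by rewrite -hLw mulrC mulKf// gt_eqF.
rewrite hL; apply: le_trans (ler_wpM2l (m_ge0 y) (fw y)) _.
rewrite le_eqVlt; apply/orP; left; apply/eqP; rewrite /w; field.
by rewrite gt_eqF.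
Qed.

Let resolvent_steps mu n a f x : 0 < mu -> mu < h -> 0 <= a -> a <= 1 ->
  sq_summable m f -> (forall x, 0 <= f x) ->
  (forall x, f x <= 1 - a * (1 - mu / h) ^+ n * w x) ->
  iter n (resolvent mu) f x <= 1 - a * w x.
Proof.
move=> mu0 muh + + sf f0.
have c0 : 0 <= 1 - mu / h by rewrite subr_ge0 ler_pdivrMr// mul1r ltW.
have c1 : 1 - mu / h <= 1 by rewrite lerBlDr lerDl divr_ge0// ltW.
elim: n a x => [|n ih] a x a0 a1 fw; first by have := fw x; rewrite expr0 mulr1.
rewrite iterS; apply: resolvent_step => //.
- exact: sq_iter_resolvent.
- by move=> y; exact: iter_resolvent_ge0.
move=> y; apply: ih => [||z].
- exact: mulr_ge0.
- exact: mulr_ile1.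
- by rewrite -(mulrA a) -exprS.
Qed.

Let semigroup_le_w T f x : 0 < T -> sq_summable m f -> (forall x, 0 <= f x) ->
  (forall x, f x <= 1 - expR (- (T / h)) * w x) -> P T f x <= 1 - w x.
Proof.
move=> T0 sf f0 fw; apply: (cvgr_to_le (@exponential_formula T f x T0 sf)).
near=> n.
have n0 : (0 : R) < n.+1%:R by rewrite ltr0n.
have mu0 : 0 < T / n.+1%:R by rewrite divr_gt0.
have muh : T / n.+1%:R < h.
  rewrite ltr_pdivrMr// mulrC -ltr_pdivrMr//.
  apply: lt_le_trans (truncnS_gt _) _; rewrite ler_nat ltnS.
  near: n; exact: nbhs_infty_ge.
rewrite -[X in _ - X]mul1r.
apply: resolvent_steps => // y; apply: le_trans (fw y) _.
rewrite mul1r lerD2l lerN2 ler_wpM2r//.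
have -> : - (T / h) = n.+1%:R * (- (T / n.+1%:R / h)).
  by field; rewrite !gt_eqF.
rewrite expRM_natl; apply: lerXn2r.
- by rewrite nnegrE subr_ge0 ler_pdivrMr// mul1r ltW.
- by rewrite nnegrE expR_ge0.
- exact: expR_ge1Dx.
Unshelve. all: by end_near. Qed.

(** Let [w = 1 - J_h 1].  If a nonzero [w] existed, it would witness a loss of
    mass: [P_T f <= 1 - w] whenever [f <= 1 - A w] with [A = e^(-T/h) < 1].  For
    truncations [f] of [1 - A w] increasing to it, [P_T 1 = 1] turns this into the
    implication from [w <= B] to [w <= A B]. *)
Lemma min_sol_one x0 : min_sol h one x0 = 1.
Proof.
have [T T0 hT] := hSC.
set A := expR (- (T / h)).
have A0 : 0 <= A by exact: expR_ge0.
have A1 : A < 1 by rewrite expR_lt1 oppr_lt0 divr_gt0.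
have p0 x y : 0 <= P T (delta y) x.
  by apply: semigroup_ge0 => //; exact: sq_delta.
have bp x : abs_summable (fun y => P T (delta y) x).
  by apply: (@abs_summable_ge0 _ _ _ 1) => // k; exact: psum_semigroup_delta_le1.
have p1 x : psum k (fun y => P T (delta y) x) @[k --> \oo] --> (1 : R).
  have <- : asum (fun y => P T (delta y) x) = 1; last exact: cvg_psum.
  rewrite -(hT x) /semigroup_ext /heat_kernel; apply: eq_asum => y.
  by rewrite mulr1 divfK// gt_eqF.
have step B : 0 <= B -> B <= 1 -> (forall x, w x <= B) -> forall x, w x <= A * B.
  move=> B0 B1 wB y.
  have AB : A * B <= 1 by apply: mulr_ile1 => //; exact: ltW.
  suff : (1 - A * B) * 1 <= 1 - w y by lra.
  have c : (1 - A * B) * psum k (fun z => P T (delta z) y) @[k --> \oo] -->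
    (1 - A * B) * 1 by apply: cvgMr; exact: p1.
  apply: (cvgr_to_le c); apply: nearW => k.
  have F0 z : 0 <= 1 - A * w z.
    by rewrite subr_ge0; apply: mulr_ile1 => //; exact: ltW.
  apply: (@le_trans _ _ (P T (trunc k (fun z => 1 - A * w z)) y)).
    rewrite semigroup_trunc ?(ltW T0)// -psumZ; apply: le_psum => z.
    by apply: ler_wpM2r => //; rewrite lerD2l lerN2 ler_wpM2l.
  apply: semigroup_le_w => //; first exact: sq_trunc.
    by move=> z; apply: trunc_ge0.
  by move=> z; apply: trunc_le.
have wA n : forall y, w y <= A ^+ n.
  elim: n => [|n ih]; first exact: w_le1.
  rewrite exprS; apply: step => //; first exact: exprn_ge0.
  by apply: exprn_ile1 => //; exact: ltW.
suff : w x0 <= 0 by have := w_ge0 x0; rewrite /w /s; lra.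
have c : A ^+ n @[n --> \oo] --> (0 : R) by apply: cvg_expr; rewrite ger0_norm.
apply: (cvgr_to_ge c).
by apply: nearW => n; exact: wA.
Qed.

End StochasticCompleteness.

(** * Positive alpha-harmonic functions in l^1 *)

Section AlphaHarmonic.
Hypothesis hSC : stochastically_complete m P.
Variables (alpha : R) (u : X -> R).
Hypothesis alpha_gt0 : 0 < alpha.
Hypothesis u_ge0 : forall x, 0 <= u x.
Hypothesis u_nbr : nbr_summable u.
Hypothesis u_harmonic : forall x, deg x * u x - nbr u x = - (alpha * u x * m x).
Hypothesis u_l1 : abs_summable (fun x => u x * m x).

Let mass := asum (fun x => u x * m x).

Let mass_ge0 : 0 <= mass.
Proof. by apply: asum_ge0 => x; rewrite mulr_ge0. Qed.

Lemma l1_dot f g C : (forall x, `|f x| <= C * u x) -> (forall x, `|g x| <= 1) ->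
  abs_summable (fun x => f x * g x * m x).
Proof.
move=> fu g1; apply: abs_summable_le (abs_summableZ C u_l1) => x.
rewrite !normrM (ger0_norm (m_ge0 x)) mulrA ler_wpM2r//.
by rewrite -[leRHS]mulr1; apply: ler_pM.
Qed.

(** In this section [w] is the resolvent of [u] at step [h]; it is the minimal
    solution since [u] itself need not be square summable. *)

Section SmallStep.
Variable h : R.
Hypothesis h_gt0 : 0 < h.
Hypothesis h_small : h * alpha < 1.
Let c := 1 - h * alpha.
Let c_gt0 : 0 < c. Proof. by rewrite subr_gt0. Qed.
Let w := min_sol h u.

Lemma super_nbr : nbr_summable (fun x => c^-1 * u x).
Proof.
by move=> x; apply: abs_summable_eq (abs_summableZ c^-1 (u_nbr x)) => y; ring.
Qed.

(** As [Delta u = - alpha u], the operator [1 + h Delta] multiplies [u] by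
    [1 - h alpha]. *)
Lemma super_shifted x : shifted h (fun x => c^-1 * u x) x = m x * u x.
Proof.
rewrite /shifted; have -> : nbr (fun x => c^-1 * u x) x = c^-1 * nbr u x.
  by rewrite /nbr -asumZ//; apply: eq_asum => y; ring.
have -> : nbr u x = deg x * u x + alpha * u x * m x.
  by have := u_harmonic x; lra.
by rewrite /c; field; rewrite -/c gt_eqF.
Qed.

Lemma u_locally_bounded : locally_bounded h u.
Proof.
apply: (@super_locally_bounded _ h_gt0 _ (fun x => c^-1 * u x)).
- exact: super_nbr.
- by move=> x; rewrite mulr_ge0// invr_ge0 ltW.
- by move=> x; rewrite super_shifted.
Qed.

Let lu := u_locally_bounded.

Lemma w_ge0 x : 0 <= w x.
Proof. exact: min_sol_ge0. Qed.

Lemma w_le x : c * w x <= u x.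
Proof.
rewrite mulrC -ler_pdivlMr// mulrC.
apply: (@min_sol_le_super _ h_gt0 _ (fun x => c^-1 * u x)) => //.
- exact: super_nbr.
- by move=> y; rewrite mulr_ge0// invr_ge0 ltW.
- by move=> y; rewrite super_shifted.
Qed.

Lemma w_norm_le x : `|w x| <= c^-1 * u x.
Proof.
by rewrite (ger0_norm (w_ge0 x)) mulrC ler_pdivlMr// mulrC w_le.
Qed.

Lemma u_norm_le x : `|u x| <= 1 * u x.
Proof. by rewrite ger0_norm// mul1r. Qed.

Lemma resolvent_norm_le1 psi x : sq_summable m psi -> (forall x, 0 <= psi x) ->
  (forall x, psi x <= 1) -> `|resolvent h psi x| <= 1.
Proof.
move=> spsi p0 p1; rewrite ger0_norm; first exact: resolvent_le_cst.
exact: resolvent_ge0.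
Qed.

(** Symmetry of the resolvent extends to the pairing of [u] with bounded
    functions, by truncating [u]. *)
Lemma dot_w psi : sq_summable m psi -> (forall x, 0 <= psi x) ->
  (forall x, psi x <= 1) -> dot m w psi = dot m u (resolvent h psi).
Proof.
move=> spsi p0 p1.
have pn x : `|psi x| <= 1 by rewrite ger0_norm.
have tk0 k x : 0 <= trunc k u x by exact: trunc_ge0.
have tku k x : trunc k u x <= u x by exact: trunc_le.
have sk k := sq_trunc k u.
have lk k : locally_bounded h (trunc k u).
  by apply: sq_locally_bounded.
have up k x : min_sol h (trunc k u) x <= w x.
  apply: min_sol_le => // l; apply: le_trans (iterate_le_min_sol h_gt0 l x u_ge0 lu).
  exact: iterate_le.
have lo k x : iterate h u k x <= min_sol h (trunc k u) x.
  rewrite (@iterate_local h u (trunc k u)) => [|y yk]; last by rewrite /trunc yk.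
  exact: iterate_le_min_sol.
have c1 : dot m (min_sol h (trunc k u)) psi @[k --> \oo] --> dot m w psi.
  apply: (@tannery _ _ _ _ (fun x => w x * psi x * m x)).
  - apply: (@l1_dot _ _ c^-1) => //; exact: w_norm_le.
  - move=> k x; rewrite ger0_norm ?mulr_ge0//; last exact: min_sol_ge0.
    by rewrite ler_wpM2r// ler_wpM2r.
  - move=> x; apply: cvgMl; apply: cvgMl.
    apply: (squeeze_cvgr _ (@min_sol_cvg h h_gt0 u x u_ge0 lu) (cvg_cst (w x))).
    by apply: nearW => k; rewrite lo up.
have c2 : dot m (trunc k u) (resolvent h psi) @[k --> \oo] --> dot m u (resolvent h psi).
  apply: (@tannery _ _ _ _ (fun x => u x * resolvent h psi x * m x)).
  - apply: (@l1_dot _ _ 1) => [|x]; first exact: u_norm_le.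
    exact: resolvent_norm_le1.
  - have r0 x : 0 <= resolvent h psi x by exact: resolvent_ge0.
    by move=> k x; rewrite ger0_norm ?mulr_ge0// ler_wpM2r// ler_wpM2r.
  - by move=> x; apply: cvgMl; apply: cvgMl; exact: cvg_trunc.
have E k : dot m (min_sol h (trunc k u)) psi = dot m (trunc k u) (resolvent h psi).
  by rewrite -resolvent_ge0E// resolvent_sym.
rewrite (funext E) in c1; exact: (cvg_unique _ c1 c2).
Qed.

(** By symmetry the mass of the resolvent of [u] is the pairing of [u] with the
    resolvent of 1, which is 1; the truncations of 1 make both sides meaningful. *)
Lemma mass_w : mass <= asum (fun x => w x * m x).
Proof.
have bw : abs_summable (fun x => w x * m x).
  apply: abs_summable_le (abs_summableZ c^-1 u_l1) => x.
  by rewrite normrM (ger0_norm (m_ge0 x)) mulrA ler_wpM2r// w_norm_le.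
pose one k := trunc k (fun=> 1 : R).
have o0 k x : 0 <= one k x by exact: trunc_ge0.
have o1 k x : one k x <= 1 by exact: (@trunc_le k (fun=> 1)).
have so k : sq_summable m (one k) := sq_trunc k _.
have l1 := one_locally_bounded h_gt0.
have r1 k x : resolvent h (one k) x <= 1 by exact: resolvent_le_cst.
have r0 k x : 0 <= resolvent h (one k) x by exact: resolvent_ge0.
have lo k x : iterate h (fun=> 1) k x <= resolvent h (one k) x.
  rewrite resolvent_ge0E//.
  rewrite (@iterate_local h _ (one k)) => [|y yk]; last by rewrite /one /trunc yk.
  by apply: iterate_le_min_sol => //; exact: sq_locally_bounded.
have rc x : resolvent h (one k) x @[k --> \oo] --> (1 : R).
  have c1 := @min_sol_cvg h h_gt0 (fun=> 1) x (fun=> ler01) l1.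
  rewrite (min_sol_one hSC h_gt0) in c1.
  apply: (squeeze_cvgr _ c1 (cvg_cst (1 : R))).
  by apply: nearW => k; rewrite lo r1.
have c2 : dot m u (resolvent h (one k)) @[k --> \oo] --> asum (fun x => u x * 1 * m x).
  apply: (@tannery _ _ _ _ (fun x => u x * m x)) => // [k x|x].
    by rewrite ger0_norm ?mulr_ge0// ler_wpM2r// ler_piMr.
  by apply: cvgMl; apply: cvgMr; exact: rc.
rewrite /mass (@eq_asum _ _ _ (fun x => u x * 1 * m x)); last by move=> x; rewrite mulr1.
apply: (cvgr_to_le c2); apply: nearW => k; rewrite -dot_w//.
apply: le_asum => // [|x].
  apply: (@l1_dot _ _ c^-1) => [|x]; first exact: w_norm_le.
  by rewrite ger0_norm.
by rewrite ler_wpM2r// ler_piMr// w_ge0.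
Qed.

(** Up to normalization, the mass entering from infinity during a time of order
    [h]. *)
Let defect x := u x - c * w x.

Let defect_ge0 x : 0 <= defect x.
Proof. by rewrite subr_ge0 w_le. Qed.

Lemma defect_norm_le x : `|defect x| <= 1 * u x.
Proof.
by rewrite (ger0_norm (defect_ge0 x)) mul1r lerBlDr lerDl mulr_ge0 ?(ltW c_gt0)// w_ge0.
Qed.

Lemma mass_defect : asum (fun x => defect x * m x) <= h * alpha * mass.
Proof.
have bw : abs_summable (fun x => w x * m x).
  apply: abs_summable_le (abs_summableZ c^-1 u_l1) => x.
  by rewrite normrM (ger0_norm (m_ge0 x)) mulrA ler_wpM2r// w_norm_le.
rewrite (@eq_asum _ _ _ (fun x => u x * m x - c * (w x * m x))); last first.
  by move=> x; rewrite /defect; ring.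
rewrite asumB//; last exact: abs_summableZ.
rewrite asumZ// -/mass; have := ler_wpM2l (ltW c_gt0) mass_w.
by rewrite /c; lra.
Qed.

(** The resolvent identity: [v = J_(1/alpha) psi] satisfies [L v = alpha (psi - v)],
    so [(1 + h L) v] is the combination of [v] and [psi] on the right-hand side. *)
Lemma resolvent_identity psi : sq_summable m psi ->
  resolvent alpha^-1 psi =
  fun x => c * resolvent h (resolvent alpha^-1 psi) x + h * alpha * resolvent h psi x.
Proof.
move=> sp; have ai : 0 < alpha^-1 by rewrite invr_gt0.
have sg := sq_resolvent ai sp.
rewrite -{1}(resolvent_of_laplacian h_gt0 (dirichlet_laplacian_resolvent ai sp)).
rewrite invrK.
rewrite (_ : (fun x => _) = fun x => c * resolvent alpha^-1 psi x + h * alpha * psi x).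
  rewrite resolvent_lin//; last exact: sq_summableZ.
  have := @resolvent_lin h h_gt0 (h * alpha) psi (fun x => psi x - psi x) sp (sq_summableB m_ge0 sp sp).
  rewrite resolventB//.
  under [X in resolvent h X = _]eq_fun do rewrite subrr addr0.
  by move=> ->; apply/funext => x; rewrite subrr addr0.
by apply/funext => x; rewrite /c; ring.
Qed.

Lemma dot_defect psi : sq_summable m psi -> (forall x, 0 <= psi x) ->
  (forall x, psi x <= 1) ->
  dot m defect (resolvent alpha^-1 psi) = h * alpha * dot m w psi.
Proof.
move=> sp p0 p1; have ai : 0 < alpha^-1 by rewrite invr_gt0.
set g := resolvent alpha^-1 psi.
have sg : sq_summable m g := sq_resolvent ai sp.
have g0 x : 0 <= g x by exact: resolvent_ge0.
have g1 x : g x <= 1 by exact: resolvent_le_cst.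
have gn x : `|g x| <= 1 by rewrite ger0_norm.
have bu f : (forall x, `|f x| <= 1) -> abs_summable (fun x => u x * f x * m x).
  by move=> f1; apply: (@l1_dot _ _ 1) => //; exact: u_norm_le.
have bw f : (forall x, `|f x| <= 1) -> abs_summable (fun x => w x * f x * m x).
  by move=> f1; apply: (@l1_dot _ _ c^-1) => //; exact: w_norm_le.
have E1 : dot m defect g = dot m u g - c * dot m w g.
  rewrite /dot -(asumZ c (bw _ gn)) -(asumB (bu _ gn) (abs_summableZ c (bw _ gn))).
  by apply: eq_asum => x; rewrite /defect; ring.
rewrite E1 !dot_w// {1}/g resolvent_identity//.
have rg x : `|resolvent h g x| <= 1 by exact: resolvent_norm_le1.
have rp x : `|resolvent h psi x| <= 1 by exact: resolvent_norm_le1.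
rewrite /dot -(asumZ c (bu _ rg)) -(asumZ (h * alpha) (bu _ rp)).
have bl : abs_summable (fun x => u x *
    (c * resolvent h (resolvent alpha^-1 psi) x + h * alpha * resolvent h psi x) * m x).
  by apply: abs_summable_eq (bu _ gn) => x; rewrite /g {1}resolvent_identity.
rewrite -(asumB bl (abs_summableZ c (bu _ rg))).
by apply: eq_asum => x; rewrite /g; ring.
Qed.

End SmallStep.

Lemma iter_resolvent_lin h a f g n : 0 < h -> sq_summable m f -> sq_summable m g ->
  iter n (resolvent h) (fun x => a * f x + g x) =
  fun x => a * iter n (resolvent h) f x + iter n (resolvent h) g x.
Proof.
by move=> h0 sf sg; elim: n => //= n ->; rewrite resolvent_lin//; exact: sq_iter_resolvent.
Qed.

Lemma iter_resolventZ h a f n : 0 < h -> sq_summable m f ->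
  iter n (resolvent h) (fun x => a * f x) = fun x => a * iter n (resolvent h) f x.
Proof.
move=> h0 sf; have sB := sq_summableB m_ge0 sf sf.
have := iter_resolvent_lin a n h0 sf sB; rewrite iter_resolventB//.
under [X in iter _ _ X = _]eq_fun do rewrite subrr addr0.
by move=> ->; apply/funext => x; rewrite subrr addr0.
Qed.

Lemma iter_resolvent_le h f g n x : 0 < h -> sq_summable m f -> sq_summable m g ->
  (forall x, f x <= g x) -> iter n (resolvent h) f x <= iter n (resolvent h) g x.
Proof.
move=> h0 sf sg fg; elim: n x => //= n ih x.
by apply: resolvent_le => //; exact: sq_iter_resolvent.
Qed.

(** One step of length [h] keeps at least the fraction [1 / (1 + h deg / m)] of a
    point mass in place. *)
Lemma delta_le_resolvent h y x : 0 < h ->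
  delta y x <= (1 + h * (deg y / m y)) * resolvent h (delta y) x.
Proof.
move=> h0; have sd := sq_delta y; have d0 := delta_ge0 y.
have r0 : 0 <= resolvent h (delta y) x by exact: resolvent_ge0.
have e0 : 0 <= 1 + h * (deg y / m y).
  by rewrite addr_ge0// mulr_ge0 ?(ltW h0)// divr_ge0// deg_ge0.
rewrite {1}/delta; case: eqP => [->|_]; last exact: mulr_ge0.
have := min_sol_ge h0 y d0 (sq_locally_bounded h0 d0 sd).
rewrite -(resolvent_ge0E h0 sd d0) {1}/delta eqxx mulr1 => H.
apply: (@le_trans _ _ 1) => //; rewrite -(ler_pM2l (m_gt0 y)) mulr1.
apply: le_trans H _; rewrite le_eqVlt; apply/orP; left; apply/eqP.
by field; rewrite gt_eqF.
Qed.

(** Iterating the resolvent identity writes the left-hand side as a discounted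
    [n]-step remainder plus contributions of the steps up to [n]; each of these is
    compared with the last one by [delta_le_resolvent]. *)
Lemma resolvent_delta_step h y n x : 0 < h -> h * alpha < 1 ->
  resolvent alpha^-1 (delta y) x <=
    (1 - h * alpha) ^+ n * iter n (resolvent h) (resolvent alpha^-1 (delta y)) x +
    n%:R * (h * alpha) * (1 + h * (deg y / m y)) ^+ n * iter n (resolvent h) (delta y) x.
Proof.
move=> h0 ha; have ai : 0 < alpha^-1 by rewrite invr_gt0.
set g := resolvent alpha^-1 _; have sd := sq_delta y; have d0 := delta_ge0 y.
have sg : sq_summable m g by exact: sq_resolvent.
set c := 1 - _; set e := 1 + _.
have ha0 : 0 <= h * alpha by rewrite mulr_ge0 ?ltW.
have c0 : 0 <= c by rewrite subr_ge0 ltW.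
have c1 : c <= 1 by rewrite lerBlDr lerDl.
have e1 : 1 <= e by rewrite lerDl mulr_ge0 ?(ltW h0)// divr_ge0// deg_ge0.
elim: n => [|n ih]; first by rewrite expr0 mul1r !mul0r addr0.
apply: le_trans ih _.
have sJg := sq_resolvent h0 sg; have sJd := sq_resolvent h0 sd.
have E1 : iter n (resolvent h) g x = c * iter n.+1 (resolvent h) g x +
    h * alpha * iter n.+1 (resolvent h) (delta y) x.
  rewrite {1}/g (resolvent_identity h0 sd) -/g -/c.
  rewrite iter_resolvent_lin//; last exact: sq_summableZ.
  by rewrite iter_resolventZ// !iterSr.
have E2 : iter n (resolvent h) (delta y) x <= e * iter n.+1 (resolvent h) (delta y) x.
  have := @iter_resolvent_le h (delta y) (fun x => e * resolvent h (delta y) x) n x h0 sd.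
  rewrite iter_resolventZ// -iterSr; apply; first exact: sq_summableZ.
  by move=> z; exact: delta_le_resolvent.
have J0 : 0 <= iter n.+1 (resolvent h) (delta y) x by exact: iter_resolvent_ge0.
have cn : c ^+ n <= e ^+ n.+1.
  by apply: le_trans (exprn_ile1 _ c0 c1) _; exact: exprn_ege1.
have en : 0 <= n%:R * (h * alpha) * e ^+ n.
  by apply: mulr_ge0; [apply: mulr_ge0|apply: exprn_ge0; exact: le_trans e1].
rewrite E1; have := ler_wpM2l en E2; have := ler_wpM2r (mulr_ge0 ha0 J0) cn.
rewrite !exprSr -[n.+1]addn1 natrD; lra.
Qed.

Lemma resolvent_delta_le T y x : 0 < T ->
  resolvent alpha^-1 (delta y) x <=
    expR (- (alpha * T)) * P T (resolvent alpha^-1 (delta y)) x +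
    alpha * T * expR (T * (deg y / m y)) * P T (delta y) x.
Proof.
move=> T0; have ai : 0 < alpha^-1 by rewrite invr_gt0.
set g := resolvent alpha^-1 _; have sd := sq_delta y; have d0 := delta_ge0 y.
have sg : sq_summable m g by exact: sq_resolvent.
set A := expR _; set B := expR _.
have cl : A * iter n.+1 (resolvent (T / n.+1%:R)) g x +
    alpha * T * B * iter n.+1 (resolvent (T / n.+1%:R)) (delta y) x @[n --> \oo] -->
    A * P T g x + alpha * T * B * P T (delta y) x.
  apply: cvgD; apply: cvgMr.
    exact: (@exponential_formula T g x T0 sg).
  exact: (@exponential_formula T (delta y) x T0 sd).
apply: (cvgr_to_ge cl); near=> n.
have n0 : (0 : R) < n.+1%:R by rewrite ltr0n.
set h := T / n.+1%:R.
have h0 : 0 < h by rewrite divr_gt0.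
have nh : n.+1%:R * h = T by rewrite mulrC divfK// gt_eqF.
have ha : h * alpha < 1.
  rewrite /h mulrAC ltr_pdivrMr// mul1r.
  apply: lt_le_trans (truncnS_gt _) _; rewrite ler_nat ltnS.
  near: n; exact: nbhs_infty_ge.
have S := resolvent_delta_step y n.+1 x h0 ha; apply: (le_trans S); rewrite -/g.
have J0 : 0 <= iter n.+1 (resolvent h) (delta y) x by exact: iter_resolvent_ge0.
have G0 : 0 <= iter n.+1 (resolvent h) g x.
  by apply: iter_resolvent_ge0 => // z; exact: resolvent_ge0.
apply: lerD; apply: ler_wpM2r => //.
  rewrite /A (_ : - (alpha * T) = n.+1%:R * - (h * alpha)); last first.
    by rewrite -nh; ring.
  rewrite expRM_natl; apply: lerXn2r.
  - by rewrite nnegrE subr_ge0 ltW.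
  - by rewrite nnegrE expR_ge0.
  - exact: expR_ge1Dx.
rewrite mulrA nh (mulrC T) ler_wpM2l ?mulr_ge0 ?(ltW alpha_gt0) ?(ltW T0)//.
rewrite /B -[in expR _]nh -mulrA expRM_natl; apply: lerXn2r.
- by rewrite nnegrE addr_ge0// mulr_ge0 ?(ltW h0)// divr_ge0// deg_ge0.
- by rewrite nnegrE expR_ge0.
- exact: expR_ge1Dx.
Unshelve. all: by end_near. Qed.

(** The steps are [1 / (alpha (n + 2))], so that [h alpha <= 1 / 2] and all
    resolvents of [u] are bounded by [2 u]. *)

Section VanishingStep.

Let h n : R := alpha^-1 / n.+2%:R.
Let w n := min_sol (h n) u.

Let h_gt0 n : 0 < h n. Proof. by rewrite divr_gt0// invr_gt0. Qed.

Let ha n : h n * alpha = n.+2%:R^-1.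
Proof. by rewrite /h mulrAC mulVf ?mul1r// gt_eqF. Qed.

Let ha_half n : h n * alpha <= 1 / 2.
Proof. by rewrite ha mul1r lef_pV2 ?posrE// ler_nat. Qed.

Let ha_lt1 n : h n * alpha < 1.
Proof. by apply: le_lt_trans (ha_half n) _; lra. Qed.

Let cvg_h : h n @[n --> \oo] --> (0 : R).
Proof.
rewrite -(mulr0 alpha^-1); apply: cvgMr.
have := @cvg_harmonic R; rewrite -(cvg_shiftS (@harmonic R)).
exact.
Qed.

Let w0 n x : 0 <= w n x. Proof. by apply: w_ge0. Qed.

Let w_le2 n x : w n x <= 2 * u x.
Proof.
have := w_le (h_gt0 n) (ha_lt1 n) x; rewrite -/(w n).
have := ler_wpM2r (w0 n x) (ha_half n); lra.
Qed.

Let w_eq n x : m x * w n x + h n * (deg x * w n x - nbr (w n) x) = m x * u x.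
Proof.
have lu := u_locally_bounded (h_gt0 n) (ha_lt1 n).
by have [_ /(_ x)] := min_sol_eq (h_gt0 n) u_ge0 lu.
Qed.

Let w_nbr n : nbr_summable (w n).
Proof.
have lu := u_locally_bounded (h_gt0 n) (ha_lt1 n).
by have [] := min_sol_eq (h_gt0 n) u_ge0 lu.
Qed.

Lemma cvg_w x : w n x @[n --> \oo] --> u x.
Proof.
pose K := 2 * u x * (deg x / m x) + 2 * alpha * u x.
have lo : u x - h n * K @[n --> \oo] --> u x.
  by rewrite -[X in _ --> X]subr0 -(mul0r K); apply: cvgB; [exact: cvg_cst|exact: cvgMl].
have up : u x + h n * K @[n --> \oo] --> u x.
  by rewrite -[X in _ --> X]addr0 -(mul0r K); apply: cvgD; [exact: cvg_cst|exact: cvgMl].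
apply: (squeeze_cvgr _ lo up); apply: nearW => n.
have dx := deg_ge0 x; have ux := u_ge0 x; have hn := ltW (h_gt0 n).
have dm : 0 <= deg x / m x by rewrite divr_ge0.
have K1 : 0 <= 2 * u x * (deg x / m x) by apply: mulr_ge0 => //; apply: mulr_ge0.
have K2 : 0 <= 2 * alpha * u x by apply: mulr_ge0 => //; apply: mulr_ge0 => //; exact: ltW.
apply/andP; split.
  rewrite lerBlDr; apply: (@le_trans _ _ (w n x + h n * (2 * u x * (deg x / m x)))); last first.
    by rewrite lerD2l ler_wpM2l// lerDl.
  rewrite -(ler_pM2l (m_gt0 x)) -(w_eq n x).
  have -> : m x * (w n x + h n * (2 * u x * (deg x / m x))) = m x * w n x + h n * (deg x * (2 * u x)).
    by field; rewrite gt_eqF.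
  rewrite lerD2l ler_wpM2l//.
  have N0 : 0 <= nbr (w n) x by apply: nbr_ge0.
  by have := ler_wpM2l dx (w_le2 n x); lra.
have := w_le (h_gt0 n) (ha_lt1 n) x; rewrite -/(w n).
have := ler_wpM2l (mulr_ge0 hn (ltW alpha_gt0)) (w_le2 n x).
have := mulr_ge0 hn K1; rewrite /K; lra.
Qed.

Let defect n x := u x - (1 - h n * alpha) * w n x.

Let defect0 n x : 0 <= defect n x.
Proof. by rewrite subr_ge0; apply: w_le. Qed.

(** By the resolvent equation this quotient is [m (Delta + alpha)] of the resolvent
    of [u], which tends to [m (Delta + alpha) u = 0]. *)
Lemma cvg_defect x : (h n)^-1 * (defect n x * m x) @[n --> \oo] --> (0 : R).
Proof.
have E n : (h n)^-1 * (defect n x * m x) =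
    deg x * w n x - nbr (w n) x + alpha * m x * w n x.
  apply: (mulfI (lt0r_neq0 (h_gt0 n))); rewrite mulVKf ?gt_eqF//.
  by have := w_eq n x; rewrite /defect; lra.
rewrite (funext E) (_ : 0 = deg x * u x - nbr u x + alpha * m x * u x); last first.
  by rewrite u_harmonic; ring.
have c : w n x @[n --> \oo] --> u x by exact: cvg_w.
apply: cvgD; last exact: cvgMr.
apply: cvgB; first exact: cvgMr.
apply: (@tannery _ _ _ _ (fun y => 2 * (b x y * u y))).
- exact/abs_summableZ/u_nbr.
- move=> n y; rewrite ger0_norm ?mulr_ge0 ?(graph_ge0 hb)//.
  by rewrite mulrCA ler_wpM2l// (graph_ge0 hb).
- by move=> y; apply: cvgMr; exact: cvg_w.
Qed.

Variable T : R.
Hypothesis T_gt0 : 0 < T.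
Hypothesis P_C0 : forall phi, Cc phi -> C0 (P T phi).
Let A := expR (- (alpha * T)).

(** The Feller property controls the pairing of the defect with [P_T delta] far
    away, and the pointwise decay of the defect controls it on finite sets. *)
Lemma mass_at_vertex y : u y * m y <= A * dot m u (P T (delta y)).
Proof.
have sd := sq_delta y; have d0 := delta_ge0 y; have d1 := delta_le1 y.
set f := P T (delta y).
have f0 x : 0 <= f x by exact: semigroup_ge0.
have f1 x : f x <= 1 by exact: semigroup_le_cst.
have fn x : `|f x| <= 1 by rewrite ger0_norm.
have sf : sq_summable m f by apply: sq_semigroup => //; exact: ltW.
set g := resolvent alpha^-1 (delta y).
have ai : 0 < alpha^-1 by rewrite invr_gt0.
have sg : sq_summable m g by exact: sq_resolvent.
have g0 x : 0 <= g x by exact: resolvent_ge0.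
have g1 x : g x <= 1 by exact: resolvent_le_cst.
have E : P T g = resolvent alpha^-1 f by rewrite semigroup_resolvent// ltW.
have r0 x : 0 <= resolvent alpha^-1 f x by exact: resolvent_ge0.
have r1 x : resolvent alpha^-1 f x <= 1 by exact: resolvent_le_cst.
set C := T * expR (T * (deg y / m y)).
have C0' : 0 <= C by rewrite mulr_ge0 ?expR_ge0// ltW.
have bd n q : (forall x, `|q x| <= 1) -> abs_summable (fun x => defect n x * q x * m x).
  by move=> q1; apply: (@l1_dot _ _ 1) => // x; apply: defect_norm_le.
have bdm n : abs_summable (fun x => defect n x * m x).
  apply: abs_summable_eq (bd n (fun=> 1) _) => [x|x]; first by rewrite mulr1.
  by rewrite normr1.
have step1 n : w n y * m y <= A * dot m (w n) f + C * ((h n)^-1 * dot m (defect n) f).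
  have H : dot m (defect n) g <=
      A * dot m (defect n) (resolvent alpha^-1 f) + alpha * C * dot m (defect n) f.
    have bg : abs_summable (fun x => defect n x * g x * m x).
      by apply: bd => x; rewrite ger0_norm.
    have br : abs_summable (fun x => defect n x * resolvent alpha^-1 f x * m x).
      by apply: bd => x; rewrite ger0_norm.
    have bf := bd n f fn.
    rewrite /dot -(asumZ A br) -(asumZ (alpha * C) bf).
    rewrite -(asumD (abs_summableZ A br) (abs_summableZ (alpha * C) bf)).
    apply: le_asum => // [|x]; first by apply: abs_summableD; exact: abs_summableZ.
    have := @resolvent_delta_le T y x T_gt0; rewrite -/g E -/f -/A => K.
    have dm0 : 0 <= defect n x * m x by rewrite mulr_ge0.
    by have := ler_wpM2l dm0 K; rewrite /C; lra.
  rewrite !dot_defect// in H.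
  have pa : 0 < h n * alpha by rewrite mulr_gt0.
  have dw : dot m (w n) (delta y) = w n y * m y.
    have [k yk] := initseg_seq [:: y].
    have {}yk : y \in initseg k by apply: yk; rewrite inE.
    rewrite /dot (@asum_supp _ _ k) => [|x xk].
      rewrite /psum (bigD1_seq y) ?initseg_uniq//= big1 ?addr0 /delta ?eqxx ?mulr1//.
      by move=> x /negbTE ->; rewrite mulr0 mul0r.
    rewrite /delta; case: eqP => [xy|_]; last by rewrite mulr0 mul0r.
    by move: xk; rewrite xy yk.
  rewrite -/(w n) dw in H.
  rewrite -(ler_pM2l pa) mulrDr.
  have -> : h n * alpha * (C * ((h n)^-1 * dot m (defect n) f)) = alpha * C * dot m (defect n) f.
    by field; rewrite gt_eqF.
  by move: H; lra.
apply/ler_addgt0Pr => e e0.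
pose eps := e / (C * alpha * mass + 1).
have D0 : 0 <= C * alpha * mass by apply: mulr_ge0 => //; apply: mulr_ge0 => //; exact: ltW.
have D1 : 0 < C * alpha * mass + 1 by rewrite ltr_wpDl.
have eps0 : 0 < eps by rewrite divr_gt0.
have Ccd : Cc (delta y).
  apply/fin_suppP; have [k yk] := initseg_seq [:: y]; exists k => x.
  by rewrite /delta; case: eqP => // ->; rewrite yk// inE.
have [psi /fin_suppP[k pk] fpsi] := P_C0 Ccd eps0.
have f_small x : x \notin initseg k -> f x <= eps.
  move=> xk; have := fpsi x; rewrite (pk x xk) subr0; apply: le_trans.
  exact: ler_norm.
have step2 n : (h n)^-1 * dot m (defect n) f <=
    psum k (fun x => (h n)^-1 * (defect n x * m x)) + eps * alpha * mass.
  have H : dot m (defect n) f <= psum k (fun x => defect n x * m x) +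
      eps * asum (fun x => defect n x * m x).
    have bt : abs_summable (trunc k (fun x => defect n x * m x)).
      by apply: (@abs_summable_supp _ _ k) => x; exact: trunc_out.
    have -> : psum k (fun x => defect n x * m x) =
        asum (trunc k (fun x => defect n x * m x)).
      rewrite (@asum_supp _ _ k) => [|x]; last exact: trunc_out.
      by rewrite /psum !big_seq; apply: eq_bigr => x xk; rewrite /trunc xk.
    rewrite -(asumZ eps (bdm n)) -(asumD bt (abs_summableZ eps (bdm n))).
    apply: le_asum; [exact: bd|by apply: abs_summableD => //; exact: abs_summableZ|move=> x].
    have dm0 : 0 <= defect n x * m x by rewrite mulr_ge0.
    rewrite mulrAC /trunc; case: ifPn => xk.
      by rewrite ler_wpDr ?ler_piMr// mulr_ge0// ltW.
    by rewrite add0r mulrC ler_wpM2r// f_small.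
  have hi : 0 <= (h n)^-1 by rewrite invr_ge0 ltW.
  rewrite psumZ; apply: le_trans (ler_wpM2l hi H) _; rewrite mulrDr lerD2l.
  have M := mass_defect (h_gt0 n) (ha_lt1 n); rewrite -/(w n) in M.
  have {}M : (h n)^-1 * asum (fun x => defect n x * m x) <= alpha * mass.
    by rewrite mulrC ler_pdivrMr// mulrC mulrA.
  by have := ler_wpM2l (ltW eps0) M; lra.
have c1 : w n y * m y @[n --> \oo] --> u y * m y by apply: cvgMl; exact: cvg_w.
have c2 : A * dot m (w n) f + C * (psum k (fun x => (h n)^-1 * (defect n x * m x)) +
      eps * alpha * mass) @[n --> \oo] -->
    A * dot m u f + C * (psum k (fun _ : X => 0 : R) + eps * alpha * mass).
  apply: cvgD; apply: cvgMr.
    apply: (@tannery _ _ _ _ (fun x => 2 * (u x * f x * m x))).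
    - by apply: abs_summableZ; apply: (@l1_dot _ _ 1) => //; exact: u_norm_le.
    - move=> n x; rewrite ger0_norm ?mulr_ge0// !mulrA.
      by rewrite ler_wpM2r// ler_wpM2r.
    - by move=> x; apply: cvgMl; apply: cvgMl; exact: cvg_w.
  apply: cvgD; last exact: cvg_cst.
  by apply: cvg_psum_fun => x; exact: cvg_defect.
have lim : u y * m y <=
    A * dot m u f + C * (psum k (fun _ : X => 0 : R) + eps * alpha * mass).
  apply: (ler_cvg_to c1 c2); apply: nearW => n; apply: le_trans (step1 n) _.
  by rewrite lerD2l ler_wpM2l.
apply: le_trans lim _; rewrite lerD2l /psum big1// add0r.
have -> : C * (eps * alpha * mass) = (C * alpha * mass) * e / (C * alpha * mass + 1).
  by rewrite /eps; field; rewrite gt_eqF.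
by rewrite ler_pdivrMr// mulrC ler_wpM2l ?(ltW e0)// lerDl.
Qed.

(** Summing the bound at a vertex over all vertices gives [mass <= A mass], as the
    functions [P_T delta_y] add up to at most 1. *)
Lemma l1_alpha_harmonic_eq0 x : u x = 0.
Proof.
have A0 : 0 <= A by exact: expR_ge0.
have A1 : A < 1 by rewrite expR_lt1 oppr_lt0 mulr_gt0.
suff H : mass <= A * mass.
  have m0 : mass <= 0 by rewrite -(pmulr_rle0 _ (_ : 0 < 1 - A)) ?subr_gt0//; lra.
  have := le_trans (le1_asum (f := fun x => u x * m x) x _ u_l1) m0.
  rewrite pmulr_lle0// => ux; apply/eqP; rewrite eq_le u_ge0 andbT; apply: ux.
  by move=> y; rewrite mulr_ge0.
apply: asum_le => // k.
have p0 y z : 0 <= P T (delta y) z.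
  by apply: semigroup_ge0 => //; exact: sq_delta.
have p1 y z : `|P T (delta y) z| <= 1.
  by rewrite ger0_norm//; apply: semigroup_le_cst => //; [exact: sq_delta|exact: delta_le1].
have bp y : abs_summable (fun z => u z * P T (delta y) z * m z).
  by apply: (@l1_dot _ _ 1) => //; exact: u_norm_le.
apply: (@le_trans _ _ (A * psum k (fun y => dot m u (P T (delta y))))).
  by rewrite -psumZ; apply: le_psum => y; exact: mass_at_vertex.
apply: ler_wpM2l => //.
have S (s : seq X) : abs_summable (fun z => u z * (\sum_(y <- s) P T (delta y) z) * m z) /\
    \sum_(y <- s) dot m u (P T (delta y)) =
    asum (fun z => u z * (\sum_(y <- s) P T (delta y) z) * m z).
  elim: s => [|y s [bs ih]].
    have E z : u z * (\sum_(y <- [::]) P T (delta y) z) * m z = 0.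
      by rewrite big_nil mulr0 mul0r.
    rewrite (funext E) asum0 big_nil; split => //.
    by apply: (@abs_summable_supp _ _ 0%N).
  have E z : u z * P T (delta y) z * m z + u z * (\sum_(y <- s) P T (delta y) z) * m z =
      u z * (\sum_(y <- y :: s) P T (delta y) z) * m z.
    by rewrite big_cons; ring.
  rewrite -(funext E); split; first exact: abs_summableD.
  by rewrite big_cons ih -asumD.
have [bs Es] := S (initseg k); rewrite /psum Es.
apply: le_asum => // z; rewrite ler_wpM2r// ler_piMr//.
exact: psum_semigroup_delta_le1.
Qed.

End VanishingStep.

End AlphaHarmonic.

End Semigroup.
End Graph.

Theorem theorem6p2 (R : realType) (X : countType) (m : X -> R)
    (m_gt0 : forall x, 0 < m x) (b : X -> X -> R) (hb : is_graph b)
    (hconn : connected_graph b) (P : R -> (X -> R) -> X -> R)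
    (hP : is_dirichlet_semigroup m b P)
    (hSC : stochastically_complete m P) (hF : feller P) :
  forall alpha : R, 0 < alpha ->
  forall u : X -> R, alpha_harmonic m b alpha u -> (forall x, 0 <= u x) ->
    lp m 1 u -> forall x, u x = 0.
Proof.
move=> alpha alpha_gt0 u [/(formal_domainE hb) u_nbr harm] u0 u1.
have [T T0 hT] := hF.
apply: (l1_alpha_harmonic_eq0 m_gt0 hb hP hSC alpha_gt0 u0 u_nbr _ _ T0 hT).
  move=> x; have := harm x; rewrite laplacianE// => /(congr1 (fun z => m x * z)).
  rewrite mulr0 mulrDr mulVKf ?gt_eqF// => E.
  lra.
have um x : 0 <= u x * m x by rewrite mulr_ge0// ltW.
apply/(esum_lty um); apply: le_lt_trans u1; rewrite le_eqVlt; apply/orP; left.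
by apply/eqP/eq_esum => x _; rewrite expr1 ger0_norm.
Qed.
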